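(* Let $R$ be a local ring of Krull dimension one with regular maximal ideal $M$, let $m\in M$ be a nonzerodivisor, let $J=\bigcap_{i>0}m^iR$, and let $\widetilde{R}$ be the $mR$-adic completion of $R$. The following are equivalent: (1) $R$ is a stable ring without finite integral closure. (2) $R/J$ is a stable ring without finite integral closure. (3) There exists a nonzero prime ideal $P$ of $\widetilde{R}$ such that $P^2=0$ and $\widetilde{R}/P$ is a DVR.
   Context: All rings are commutative with identity; a local ring is a ring with a unique maximal ideal (not necessarily Noetherian). $Q(R)$ is the total ring of quotients and $\overline{R}$ the integral closure of $R$ in $Q(R)$; $R$ has finite integral closure if $\overline R$ is a finitely generated $R$-module. An ideal is regular if it contains a nonzerodivisor. For a regular fractional ideal $I$ (an $R$-submodule of $Q(R)$ containing a nonzerodivisor with $bI\subseteq R$ for some nonzerodivisor $b\in R$), $E(I)=\{q\in Q(R):qI\subseteq I\}$, and $I$ is stable if it is projective as an $E(I)$-module; $R$ is stable if every regular ideal is stable. DVR means rank one discrete valuation ring. ($J$ and $\widetilde R$ do not depend on the choice of $m$.) *)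

(* Defs.v *)
From HB Require Import structures.
From mathcomp Require Import all_boot all_order all_algebra.
Set Implicit Arguments. Unset Strict Implicit. Unset Printing Implicit Defensive.
Import Order.TTheory GRing.Theory.
Local Open Scope ring_scope.

Section Defs.
Variable R : comUnitRingType.

Definition is_ideal (I : R -> Prop) : Prop :=
  I 0 /\ (forall x y, I x -> I y -> I (x + y)) /\ (forall r x, I x -> I (r * x)).

Definition prime_ideal (P : R -> Prop) : Prop :=
  is_ideal P /\ ~ P 1 /\ (forall a b, P (a * b) -> P a \/ P b).

Definition maximal_ideal (M : R -> Prop) : Prop :=
  is_ideal M /\ ~ M 1 /\
  (forall N, is_ideal N -> (forall x, M x -> N x) -> (forall x, N x <-> M x) \/ N 1).

Definition strict_subset (A B : R -> Prop) : Prop :=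
  (forall x, A x -> B x) /\ exists x, B x /\ ~ A x.

Definition krull_dim_one : Prop :=
  (exists P0 P1, prime_ideal P0 /\ prime_ideal P1 /\ strict_subset P0 P1) /\
  ~ (exists P0 P1 P2, prime_ideal P0 /\ prime_ideal P1 /\ prime_ideal P2 /\
        strict_subset P0 P1 /\ strict_subset P1 P2).

Definition nonzerodivisor (s : R) : Prop := forall x, s * x = 0 -> x = 0.

Definition regular_ideal (I : R -> Prop) : Prop := exists s, I s /\ nonzerodivisor s.

Definition total_quotient (Q : comUnitRingType) (f : {rmorphism R -> Q}) : Prop :=
  injective f /\
  (forall s, nonzerodivisor s -> f s \is a GRing.unit) /\
  (forall q, exists a s, nonzerodivisor s /\ q * f s = f a).

Definition integral_over (Q : comUnitRingType) (f : {rmorphism R -> Q}) (q : Q) : Prop :=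
  exists p : {poly R}, p \is monic /\ root (map_poly f p) q.

Definition finite_closure_in (Q : comUnitRingType) (f : {rmorphism R -> Q}) : Prop :=
  exists gens : seq Q,
    (forall g, g \in gens -> integral_over f g) /\
    (forall q, integral_over f q ->
       exists cs : seq R, size cs = size gens /\
         q = \sum_(i < size gens) f cs`_i * gens`_i).

Definition finite_integral_closure : Prop :=
  forall (Q : comUnitRingType) (f : {rmorphism R -> Q}),
    total_quotient f -> finite_closure_in f.

(* N (an E-module inside Q, E a subring of Q) is a projective E-module:
   it is a direct summand of a free E-module E^(X); written out, the
   splitting N -> E^(X) is given by E-linear coordinate maps phi x with
   finite support, and the projection E^(X) -> N sends the basis vector
   e_x to g x. *)
Definition projective_over (Q : comUnitRingType) (E N : Q -> Prop) : Prop :=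
  exists (X : eqType) (g : X -> Q) (phi : X -> Q -> Q),
    (forall x, N (g x)) /\
    (forall x y, N y -> E (phi x y)) /\
    (forall x y z, N y -> N z -> phi x (y + z) = phi x y + phi x z) /\
    (forall x e y, E e -> N y -> phi x (e * y) = e * phi x y) /\
    (forall y, N y -> exists s : seq X, uniq s /\
        (forall x, x \notin s -> phi x y = 0) /\
        y = \sum_(x <- s) phi x y * g x).

Definition frac_of (Q : comUnitRingType) (f : {rmorphism R -> Q}) (I : R -> Prop) : Q -> Prop :=
  fun q => exists x, I x /\ q = f x.

Definition endo_ring (Q : comUnitRingType) (f : {rmorphism R -> Q}) (I : R -> Prop) : Q -> Prop :=
  fun q => forall y, frac_of f I y -> frac_of f I (q * y).

Definition stable_ideal_in (Q : comUnitRingType) (f : {rmorphism R -> Q}) (I : R -> Prop) : Prop :=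
  projective_over (endo_ring f I) (frac_of f I).

Definition stable_ring : Prop :=
  forall (Q : comUnitRingType) (f : {rmorphism R -> Q}),
    total_quotient f ->
    forall I, is_ideal I -> regular_ideal I -> stable_ideal_in f I.

(* (T, g) is (a copy of) the mR-adic completion of R: T is separated and
   complete for the g(m)T-adic topology and g induces R/m^iR ~= T/g(m)^iT *)
Definition adic_completion (T : comUnitRingType) (m : R) (g : {rmorphism R -> T}) : Prop :=
  let mT := fun (i : nat) (t : T) => exists u, t = g m ^+ i * u in
  (forall i t, exists r u, t = g r + g m ^+ i * u) /\
  (forall i r, mT i (g r) -> exists r', r = m ^+ i * r') /\
  (forall t, (forall i, mT i t) -> t = 0) /\
  (forall ts : nat -> T, (forall i, mT i (ts i.+1 - ts i)) ->
     exists t, forall i, mT i (t - ts i)).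

End Defs.

(* rank one discrete valuation ring: an integral domain D with a discrete
   valuation v (on D \ 0, extending to a surjective valuation of Frac D onto Z)
   whose valuation ring is exactly D *)
Definition is_DVR (D : comUnitRingType) : Prop :=
  (1 : D) != 0 /\
  (forall x y : D, x * y = 0 -> x = 0 \/ y = 0) /\
  exists v : D -> nat,
    (forall x y, x != 0 -> y != 0 -> v (x * y)%R = (v x + v y)%N) /\
    (forall x y, x != 0 -> y != 0 -> x + y != 0 -> (minn (v x) (v y) <= v (x + y)%R)%N) /\
    (exists t, t != 0 /\ v t = 1%N) /\
    (forall x y, x != 0 -> y != 0 -> (v x <= v y)%N -> exists z, y = z * x).

(* T/P is a DVR: some (equivalently any) ring D with a surjection T -> D with
   kernel P is a DVR *)
Definition quotient_is_DVR (T : comUnitRingType) (P : T -> Prop) : Prop :=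
  exists (D : comUnitRingType) (psi : {rmorphism T -> D}),
    (forall d, exists t, psi t = d) /\ (forall t, psi t = 0 <-> P t) /\ is_DVR D.

(* Main.v *)
(** Write [A] for [R] or [R/J] (both have the completion [T]), [M] for its maximal ideal, [C] for
    its integral closure. If [A] is stable, each module [A + Ax + Ay] with [x], [y] in [C] is
    invertible over its endomorphism ring and integral over it, hence is itself a ring. If moreover
    [C] is not finite over [A], these quadratic relations force [C] to be local with principal
    maximal ideal [MC], and [C = A + MC]; so [T] maps onto the [m]-adic completion of [C], a DVR.
    The kernel [P] consists of limits of elements of [A] highly divisible by [m] in [C]; it is
    nonzero as [C <> A], and [P^2 = 0] because [(m^n x)(m^n y)] lies in [m^n A].
    Conversely, given [P], an element [a] of least value in a regular ideal [I] satisfies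
    [I^2 = aI], so that [I] is free over its endomorphism ring; and if [r] in [A] is close to a
    nonzero [p] in [P], then [r^2] is highly divisible by [m], so elements [r/m^n] with arbitrarily
    large denominators are integral. *)

(* Why non-finiteness makes [C] local with [C = A + MC]: modulo [MC], an integral [x] outside
   [A + MC] satisfies a quadratic equation over the residue field [k] of [A], and each type of
   equation leads back to [C = A + Ax], which is finite. Without a root in [k], the norms of all
   [x - t] are units, and one may divide by them. With two distinct roots, [x] yields an idempotent
   modulo [MC]; a further generator would produce the residue algebra [k x k x k], in which a plane
   is an invertible module needing two generators. With a double root, a translate of [x] is a
   uniformizer of [C] whose square generates [MC], and then [m^2 C] lies in [A + Ax]. [MC] is
   principal because [M] itself is stable: it is generated by one element over its endomorphism
   ring, and that ring lies in [C]. No ring is assumed Noetherian and nothing is localized: an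
   invertible module is handled by picking one term of its dual basis that avoids a given additively
   closed set. Dimension one enters through a single fact: every nonunit has a power divisible by
   any given nonzerodivisor. *)
Require Import Defs.
From HB Require Import structures.
From mathcomp Require Import all_boot all_order all_algebra.
From mathcomp Require Import ring.
From mathcomp Require Import boolp classical_sets.
Import Order.TTheory GRing.Theory.
Local Open Scope ring_scope.
Set Implicit Arguments. Unset Strict Implicit. Unset Printing Implicit Defensive.

(** * Rings from setoids: quotients, total quotient rings, adic completions *)

(* Common input for the quotient rings, total quotient rings and completions below. *)
Record setoid_ring := SetoidRing {
  scar :> Type;
  seqv : scar -> scar -> Prop;
  sadd : scar -> scar -> scar;
  sopp : scar -> scar;
  smul : scar -> scar -> scar;
  szero : scar;
  sone : scar;
  seqv_refl : forall x, seqv x x;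
  seqv_sym : forall x y, seqv x y -> seqv y x;
  seqv_trans : forall x y z, seqv x y -> seqv y z -> seqv x z;
  sadd_cong : forall x x' y y', seqv x x' -> seqv y y' -> seqv (sadd x y) (sadd x' y');
  sopp_cong : forall x x', seqv x x' -> seqv (sopp x) (sopp x');
  smul_cong : forall x x' y y', seqv x x' -> seqv y y' -> seqv (smul x y) (smul x' y');
  saddA : forall x y z, seqv (sadd x (sadd y z)) (sadd (sadd x y) z);
  saddC : forall x y, seqv (sadd x y) (sadd y x);
  sadd0 : forall x, seqv (sadd szero x) x;
  saddN : forall x, seqv (sadd (sopp x) x) szero;
  smulA : forall x y z, seqv (smul x (smul y z)) (smul (smul x y) z);
  smulC : forall x y, seqv (smul x y) (smul y x);
  smul1 : forall x, seqv (smul sone x) x;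
  smulD : forall x y z, seqv (smul (sadd x y) z) (sadd (smul x z) (smul y z));
  sone_neq0 : ~ seqv sone szero
}.

Section SetoidRingQuotient.
Variable X : setoid_ring.

Definition sclass := {P : X -> Prop | exists x, P = seqv x}.
Definition scl (x : X) : sclass := exist _ (seqv x) (ex_intro _ x erefl).
Definition srepr (c : sclass) : X := sval (cid (svalP c)).

Lemma sreprK c : scl (srepr c) = c.
Proof.
case: c => P hP; apply: eq_exist; rewrite /srepr.
by case: (cid _) => x /= ->.
Qed.

Lemma scl_eq x y : scl x = scl y <-> seqv x y.
Proof.
split=> [[] e | exy]; first by rewrite e; exact: seqv_refl.
apply: eq_exist; apply: funext => z; apply: propext; split.
  by apply: seqv_trans; exact: seqv_sym.
exact: seqv_trans.
Qed.

Lemma srepr_scl x : seqv (srepr (scl x)) x.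
Proof. by apply/scl_eq; rewrite sreprK. Qed.

Definition qadd (c d : sclass) := scl (sadd (srepr c) (srepr d)).
Definition qopp (c : sclass) := scl (sopp (srepr c)).
Definition qmul (c d : sclass) := scl (smul (srepr c) (srepr d)).

Lemma qaddE x y : qadd (scl x) (scl y) = scl (sadd x y).
Proof. by apply/scl_eq; apply: sadd_cong; exact: srepr_scl. Qed.
Lemma qoppE x : qopp (scl x) = scl (sopp x).
Proof. by apply/scl_eq; apply: sopp_cong; exact: srepr_scl. Qed.
Lemma qmulE x y : qmul (scl x) (scl y) = scl (smul x y).
Proof. by apply/scl_eq; apply: smul_cong; exact: srepr_scl. Qed.

Lemma sclP (P : sclass -> Prop) : (forall x, P (scl x)) -> forall c, P c.
Proof. by move=> h c; rewrite -[c]sreprK. Qed.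

HB.instance Definition _ := gen_eqMixin sclass.
HB.instance Definition _ := gen_choiceMixin sclass.

Fact qaddA : associative qadd.
Proof.
elim/sclP=> x; elim/sclP=> y; elim/sclP=> z.
by rewrite !qaddE; apply/scl_eq; exact: saddA.
Qed.
Fact qaddC : commutative qadd.
Proof. by elim/sclP=> x; elim/sclP=> y; rewrite !qaddE; apply/scl_eq; exact: saddC. Qed.
Fact qadd0 : left_id (scl (szero X)) qadd.
Proof. by elim/sclP=> x; rewrite qaddE; apply/scl_eq; exact: sadd0. Qed.
Fact qaddN : left_inverse (scl (szero X)) qopp qadd.
Proof. by elim/sclP=> x; rewrite qoppE qaddE; apply/scl_eq; exact: saddN. Qed.
HB.instance Definition _ := GRing.isZmodule.Build sclass qaddA qaddC qadd0 qaddN.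

Fact qmulA : associative qmul.
Proof.
elim/sclP=> x; elim/sclP=> y; elim/sclP=> z.
by rewrite !qmulE; apply/scl_eq; exact: smulA.
Qed.
Fact qmulC : commutative qmul.
Proof. by elim/sclP=> x; elim/sclP=> y; rewrite !qmulE; apply/scl_eq; exact: smulC. Qed.
Fact qmul1 : left_id (scl (sone X)) qmul.
Proof. by elim/sclP=> x; rewrite qmulE; apply/scl_eq; exact: smul1. Qed.
Fact qmulD : left_distributive qmul qadd.
Proof.
elim/sclP=> x; elim/sclP=> y; elim/sclP=> z.
by rewrite !(qmulE, qaddE); apply/scl_eq; exact: smulD.
Qed.
Fact qone_neq0 : scl (sone X) != 0.
Proof. by apply/eqP => /scl_eq; exact: sone_neq0. Qed.
HB.instance Definition _ :=
  GRing.Zmodule_isComNzRing.Build sclass qmulA qmulC qmul1 qmulD qone_neq0.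

(** Units are recognised by excluded middle, so that [GRing.unit] means invertible in all rings
    built below. *)
Definition qunit : {pred sclass} := fun c => `[< exists d, d * c = 1 >].
Definition qinv (c : sclass) :=
  if pselect (exists d, d * c = 1) is left h then sval (cid h) else c.
Fact qmulV : {in qunit, left_inverse 1 qinv *%R}.
Proof.
move=> c /asboolP h; rewrite /qinv; case: pselect => // h'.
by case: (cid h').
Qed.
Fact qunitP x y : y * x = 1 -> qunit x.
Proof. by move=> h; apply/asboolP; exists y. Qed.
Fact qinv_out : {in [predC qunit], qinv =1 id}.
Proof.
move=> c; rewrite inE /= => /negP h; rewrite /qinv; case: pselect => // h'.
by case: h; apply/asboolP.
Qed.
HB.instance Definition _ :=
  GRing.ComNzRing_hasMulInverse.Build sclass qmulV qunitP qinv_out.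

Lemma scl0 : scl (szero X) = 0. Proof. by []. Qed.
Lemma scl1 : scl (sone X) = 1. Proof. by []. Qed.
Lemma sclD x y : scl (sadd x y) = scl x + scl y. Proof. by rewrite -qaddE. Qed.
Lemma sclN x : scl (sopp x) = - scl x. Proof. by rewrite -qoppE. Qed.
Lemma sclM x y : scl (smul x y) = scl x * scl y. Proof. by rewrite -qmulE. Qed.

End SetoidRingQuotient.

Lemma rmorphism_of (A B : comUnitRingType) (phi : A -> B) :
  (forall x y, phi (x + y) = phi x + phi y) ->
  (forall x y, phi (x * y) = phi x * phi y) -> phi 1 = 1 ->
  exists f : {rmorphism A -> B}, forall x, f x = phi x.
Proof.
move=> hD hM h1.
have hB : zmod_morphism phi.
  move=> x y; apply: (addIr (phi y)).
  by rewrite -hD !subrK.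
pose m1 := GRing.isZmodMorphism.Build A B phi hB.
pose m2 := GRing.isMonoidMorphism.Build A B phi (conj h1 hM).
pose F : {rmorphism A -> B} := HB.pack phi m1 m2.
by exists F.
Qed.

Lemma ideal_opp (A : comUnitRingType) (I : A -> Prop) x : is_ideal I -> I x -> I (- x).
Proof. by move=> [_ [_ h]] /(h (-1)); rewrite mulN1r. Qed.

Lemma ideal_quotient (A : comUnitRingType) (I : A -> Prop) :
  is_ideal I -> ~ I 1 ->
  exists (S : comUnitRingType) (p : {rmorphism A -> S}),
    (forall s, exists a, p a = s) /\ (forall a, p a = 0 <-> I a).
Proof.
move=> hI hI1; have [I0 [ID IM]] := hI.
pose E x y := I (x - y).
have Eeq x y : x = y -> E x y by move=> ->; rewrite /E subrr.
have Esym x y : E x y -> E y x by move=> h; rewrite /E -opprB; exact: ideal_opp.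
have Etrans x y z : E x y -> E y z -> E x z.
  by move=> h k; rewrite /E (_ : x - z = (x - y) + (y - z)); [exact: ID | ring].
have Eadd x x' y y' : E x x' -> E y y' -> E (x + y) (x' + y').
  by move=> h k; rewrite /E (_ : _ - _ = (x - x') + (y - y')); [exact: ID | ring].
have Eopp x x' : E x x' -> E (- x) (- x').
  by move=> h; rewrite /E -opprD; exact: ideal_opp.
have Emul x x' y y' : E x x' -> E y y' -> E (x * y) (x' * y').
  move=> h k; rewrite /E (_ : _ - _ = y * (x - x') + x' * (y - y')); last by ring.
  by apply: ID; exact: IM.
have E10 : ~ E 1 0 by rewrite /E subr0.
pose X := SetoidRing (fun x => Eeq x x erefl) Esym Etrans Eadd Eopp Emul
  (fun x y z => Eeq _ _ (addrA x y z)) (fun x y => Eeq _ _ (addrC x y))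
  (fun x => Eeq _ _ (add0r x)) (fun x => Eeq _ _ (addNr x))
  (fun x y z => Eeq _ _ (mulrA x y z)) (fun x y => Eeq _ _ (mulrC x y))
  (fun x => Eeq _ _ (mul1r x)) (fun x y z => Eeq _ _ (mulrDl x y z)) E10.
have [p hp] := rmorphism_of (@sclD X) (@sclM X) (@scl1 X).
exists (sclass X), p; split.
  by elim/sclP => x; exists x; rewrite hp.
move=> a; rewrite hp -scl0 scl_eq /= /E subr0; exact: iff_refl.
Qed.

Lemma nonzerodivisorM (A : comUnitRingType) (x y : A) :
  nonzerodivisor x -> nonzerodivisor y -> nonzerodivisor (x * y).
Proof. by move=> hx hy z; rewrite -mulrA => /hx /hy. Qed.

Lemma nonzerodivisorX (A : comUnitRingType) (x : A) n :
  nonzerodivisor x -> nonzerodivisor (x ^+ n).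
Proof.
move=> hx; elim: n => [|n ih]; first by move=> z; rewrite expr0 mul1r.
by rewrite exprS; exact: nonzerodivisorM.
Qed.

Lemma nonzerodivisor_cancel (A : comUnitRingType) (s x y : A) :
  nonzerodivisor s -> s * x = s * y -> x = y.
Proof.
by move=> hs h; apply/eqP; rewrite -subr_eq0; apply/eqP/hs; rewrite mulrBr h subrr.
Qed.

(** [finite_integral_closure] quantifies over every total quotient ring, so one is needed to exploit
    it. Since denominators are nonzerodivisors, equality of fractions is plain cross-multiplication,
    without an auxiliary multiplier. *)
Lemma total_quotient_exists (A : comUnitRingType) :
  exists (Q : comUnitRingType) (f : {rmorphism A -> Q}), total_quotient f.
Proof.
pose C := (A * {s : A | nonzerodivisor s})%type.
have hden (x : C) : nonzerodivisor (sval x.2) by exact: svalP.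
pose E (x y : C) := x.1 * sval y.2 = y.1 * sval x.2.
have h1 : nonzerodivisor (1 : A) by move=> z; rewrite mul1r.
pose N1 : {s : A | nonzerodivisor s} := exist _ 1 h1.
pose dm (x y : C) : {s : A | nonzerodivisor s} :=
  exist _ (sval x.2 * sval y.2) (nonzerodivisorM (hden x) (hden y)).
pose ad (x y : C) : C := (x.1 * sval y.2 + y.1 * sval x.2, dm x y).
pose op (x : C) : C := (- x.1, x.2).
pose mu (x y : C) : C := (x.1 * y.1, dm x y).
have Etrans x y z : E x y -> E y z -> E x z.
  rewrite /E => h k; apply: (nonzerodivisor_cancel (hden y)).
  transitivity ((x.1 * sval y.2) * sval z.2); first by ring.
  rewrite h; transitivity ((y.1 * sval z.2) * sval x.2); first by ring.
  by rewrite k; ring.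
have Eadd x x' y y' : E x x' -> E y y' -> E (ad x y) (ad x' y').
  rewrite /E /= => h k.
  transitivity ((x.1 * sval x'.2) * (sval y.2 * sval y'.2) + (y.1 * sval y'.2) * (sval x.2 * sval x'.2)).
    by ring.
  by rewrite h k; ring.
have Eopp x x' : E x x' -> E (op x) (op x').
  by rewrite /E /= => h; rewrite !mulNr h.
have Emul x x' y y' : E x x' -> E y y' -> E (mu x y) (mu x' y').
  rewrite /E /= => h k.
  transitivity ((x.1 * sval x'.2) * (y.1 * sval y'.2)); first by ring.
  by rewrite h k; ring.
have AA x y z : E (ad x (ad y z)) (ad (ad x y) z).
  by rewrite /E /=; ring.
have AC x y : E (ad x y) (ad y x) by rewrite /E /=; ring.
have A0 x : E (ad (0, N1) x) x by rewrite /E /=; ring.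
have AN x : E (ad (op x) x) (0, N1) by rewrite /E /=; ring.
have MA x y z : E (mu x (mu y z)) (mu (mu x y) z).
  by rewrite /E /=; ring.
have MC x y : E (mu x y) (mu y x) by rewrite /E /=; ring.
have M1 x : E (mu (1, N1) x) x by rewrite /E /=; ring.
have MD x y z : E (mu (ad x y) z) (ad (mu x z) (mu y z)).
  by rewrite /E /=; ring.
have E10 : ~ E (1, N1) (0, N1).
  by rewrite /E /= !mulr1 => /eqP; rewrite oner_eq0.
pose X := SetoidRing (fun x => erefl : E x x)
  (fun x y (h : E x y) => esym h : E y x) Etrans Eadd Eopp Emul AA AC A0 AN MA MC M1 MD E10.
have hD x y : scl ((x + y, N1) : X) = scl ((x, N1) : X) + scl ((y, N1) : X).
  by rewrite -sclD; apply/scl_eq; rewrite /= /E /=; ring.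
have hM x y : scl ((x * y, N1) : X) = scl ((x, N1) : X) * scl ((y, N1) : X).
  by rewrite -sclM; apply/scl_eq; rewrite /= /E /=; ring.
have [f hf] := rmorphism_of hD hM (@scl1 X).
exists (sclass X), f; split; last split.
- by move=> x y; rewrite !hf => /scl_eq; rewrite /= /E /= !mulr1.
- move=> s hs; apply/unitrP; exists (scl ((1, exist _ s hs) : X)).
  have h : scl ((1, exist _ s hs) : X) * f s = 1.
    by rewrite hf -sclM -scl1; apply/scl_eq; rewrite /= /E /=; ring.
  by split=> //; rewrite mulrC.
- elim/sclP => -[a s]; exists a, (sval s); split; first exact: svalP.
  by rewrite !hf -sclM; apply/scl_eq; rewrite /= /E /=; ring.
Qed.

(* Sequences that are Cauchy at the prescribed rate, modulo null sequences. *)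
Lemma adic_completion_exists (A : comUnitRingType) (m : A) :
  nonzerodivisor m -> ~ (exists r, 1 = m * r) ->
  exists (T : comUnitRingType) (g : {rmorphism A -> T}), adic_completion m g.
Proof.
move=> hm m1.
pose D i (x : A) := exists r, x = m ^+ i * r.
have D0 i : D i 0 by exists 0; rewrite mulr0.
have DD i x y : D i x -> D i y -> D i (x + y).
  by move=> [r ->] [s ->]; exists (r + s); rewrite mulrDr.
have DM i a x : D i x -> D i (a * x) by move=> [r ->]; exists (a * r); ring.
have DN i x : D i x -> D i (- x) by move=> /(DM i (-1)); rewrite mulN1r.
have Dle i j x : (i <= j)%N -> D j x -> D i x.
  move=> ij [r ->]; exists (m ^+ (j - i) * r).
  by rewrite mulrA -exprD subnKC.
pose C := {x : nat -> A | forall i, D i (x i.+1 - x i)}.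
have hc (x : C) i j : (i <= j)%N -> D i (sval x j - sval x i).
  elim: j => [|j ih]; first by rewrite leqn0 => /eqP->; rewrite subrr.
  rewrite leq_eqVlt => /orP[/eqP<-|]; first by rewrite subrr.
  rewrite ltnS => ij; rewrite (_ : _ - _ = (sval x j.+1 - sval x j) + (sval x j - sval x i)); last by ring.
  by apply: DD; [apply: (Dle i j) => //; exact: (svalP x) | exact: ih].
have had (x y : C) i : D i ((sval x i.+1 + sval y i.+1) - (sval x i + sval y i)).
  rewrite (_ : _ - _ = (sval x i.+1 - sval x i) + (sval y i.+1 - sval y i)); last by ring.
  by apply: DD; exact: hc.
have hop (x : C) i : D i (- sval x i.+1 - - sval x i) by rewrite -opprD; apply: DN; exact: hc.
have hmu (x y : C) i : D i (sval x i.+1 * sval y i.+1 - sval x i * sval y i).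
  rewrite (_ : _ - _ = sval y i.+1 * (sval x i.+1 - sval x i) + sval x i * (sval y i.+1 - sval y i)); last by ring.
  by apply: DD; apply: DM; exact: hc.
have hcst (a : A) i : D i ((fun=> a) i.+1 - (fun=> a) i) by rewrite subrr.
pose ad (x y : C) : C := exist _ _ (had x y).
pose op (x : C) : C := exist _ _ (hop x).
pose mu (x y : C) : C := exist _ _ (hmu x y).
pose cst (a : A) : C := exist _ _ (hcst a).
pose E (x y : C) := forall i, D i (sval x i - sval y i).
have Eeq (x y : C) : (forall i, sval x i = sval y i) -> E x y by move=> h i; rewrite h subrr.
have Esym x y : E x y -> E y x by move=> h i; rewrite -opprB; exact: DN.
have Etrans x y z : E x y -> E y z -> E x z.
  move=> h k i; rewrite (_ : _ - _ = (sval x i - sval y i) + (sval y i - sval z i)); last by ring.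
  exact: DD.
have Eadd x x' y y' : E x x' -> E y y' -> E (ad x y) (ad x' y').
  move=> h k i; rewrite /= (_ : _ - _ = (sval x i - sval x' i) + (sval y i - sval y' i)); last by ring.
  exact: DD.
have Eopp x x' : E x x' -> E (op x) (op x').
  by move=> h i; rewrite /= -opprD; exact: DN.
have Emul x x' y y' : E x x' -> E y y' -> E (mu x y) (mu x' y').
  move=> h k i; rewrite (_ : _ - _ = sval y i * (sval x i - sval x' i) + sval x' i * (sval y i - sval y' i)).
    by apply: DD; exact: DM.
  by rewrite /=; ring.
have AA x y z : E (ad x (ad y z)) (ad (ad x y) z) by apply: Eeq => i; exact: addrA.
have AC x y : E (ad x y) (ad y x) by apply: Eeq => i; exact: addrC.
have A0 x : E (ad (cst 0) x) x by apply: Eeq => i; exact: add0r.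
have AN x : E (ad (op x) x) (cst 0) by apply: Eeq => i; exact: addNr.
have MA x y z : E (mu x (mu y z)) (mu (mu x y) z) by apply: Eeq => i; exact: mulrA.
have MC x y : E (mu x y) (mu y x) by apply: Eeq => i; exact: mulrC.
have M1 x : E (mu (cst 1) x) x by apply: Eeq => i; exact: mul1r.
have MD x y z : E (mu (ad x y) z) (ad (mu x z) (mu y z)) by apply: Eeq => i; exact: mulrDl.
have E10 : ~ E (cst 1) (cst 0).
  by move=> /(_ 1%N) [r]; rewrite /= subr0 expr1 => h; apply: m1; exists r.
pose X := SetoidRing (fun x => Eeq x x (fun=> erefl)) Esym Etrans Eadd Eopp Emul
  AA AC A0 AN MA MC M1 MD E10.
have hD x y : scl (cst (x + y) : X) = scl (cst x : X) + scl (cst y : X).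
  by rewrite -sclD; apply/scl_eq => i; rewrite /= subrr; exact: D0.
have hM x y : scl (cst (x * y) : X) = scl (cst x : X) * scl (cst y : X).
  by rewrite -sclM; apply/scl_eq => i; rewrite /= subrr; exact: D0.
have [g hg] := rmorphism_of hD hM (@scl1 X).
have scl_sub (x y : X) : scl x - scl y = scl (ad x (op y) : X).
  by rewrite -sclN -sclD.
(* Divisibility by [g m ^+ i] is read off the term of index [i]: all later terms are then divisible
   as well, and the shifted quotients [u] are Cauchy at the prescribed rate because [m ^+ i]
   cancels. *)
have divP i (x : X) : (exists u, scl x = g m ^+ i * u) <-> D i (sval x i).
  split.
    case; elim/sclP => u; rewrite -rmorphXn hg -sclM => /scl_eq /(_ i) [r].
    rewrite /= => h; exists (r + sval u i).
    by rewrite mulrDr -h; ring.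
  move=> [r0 hr0].
  have hx j : exists r, sval x (i + j)%N = m ^+ i * r.
    have [s hs] := hc x i (i + j)%N (leq_addr _ _).
    by exists (s + r0); rewrite mulrDr -hr0 -hs; ring.
  have [u hu] := choice hx.
  have hcu j : D j (u j.+1 - u j).
    have [s hs] := hc x _ _ (leqnSn (i + j)).
    exists s; apply: (nonzerodivisor_cancel (@nonzerodivisorX _ _ i hm)).
    by rewrite mulrBr -!hu addnS hs exprD mulrA.
  exists (scl (exist _ u hcu : X)); rewrite -rmorphXn hg -sclM; apply/scl_eq => k.
  rewrite /= -hu -opprB; apply: DN; apply: hc; exact: leq_addl.
exists (sclass X), g; split; [|split; [|split]].
- move=> i; elim/sclP => x; exists (sval x i).
  have /divP [u hu] : D i (sval (ad x (op (cst (sval x i)))) i) by rewrite /= subrr; exact: D0.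
  by exists u; rewrite hg -hu -scl_sub addrC subrK.
- by move=> i r; rewrite hg => /divP.
- elim/sclP => x h; rewrite -scl0; apply/scl_eq => i; rewrite /= subr0.
  by apply/divP; exact: h.
(* The limit is the diagonal sequence: its term of index [i] agrees with [ts i] modulo [m ^+ i]. *)
- move=> ts hts; pose y i := sval (srepr (ts i)) i.
  have hcy i : D i (y i.+1 - y i).
    rewrite (_ : _ - _ = (y i.+1 - sval (srepr (ts i.+1)) i) + (sval (srepr (ts i.+1)) i - y i)); last by ring.
    apply: DD; first exact: hc.
    have h := hts i; rewrite -(sreprK (ts i.+1)) -(sreprK (ts i)) scl_sub in h.
    by move/divP: h.
  exists (scl (exist _ y hcy : X)) => i.
  rewrite -[X in _ - X]sreprK scl_sub; apply/divP; rewrite /= subrr; exact: D0.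
Qed.

Lemma rmorphism_factor (A S T : comUnitRingType) (p : {rmorphism A -> S}) (g : {rmorphism A -> T}) :
  (forall s, exists a, p a = s) -> (forall a, p a = 0 -> g a = 0) ->
  exists h : {rmorphism S -> T}, forall a, h (p a) = g a.
Proof.
move=> hp hk; have [l hl] := choice hp.
have hlp a b : p a = p b -> g a = g b.
  move=> e; apply/eqP; rewrite -subr_eq0 -rmorphB; apply/eqP/hk.
  by rewrite rmorphB e subrr.
have hD x y : g (l (x + y)) = g (l x) + g (l y).
  by rewrite -rmorphD; apply: hlp; rewrite rmorphD !hl.
have hM x y : g (l (x * y)) = g (l x) * g (l y).
  by rewrite -rmorphM; apply: hlp; rewrite rmorphM !hl.
have h1 : g (l 1) = 1 by rewrite -(rmorph1 g); apply: hlp; rewrite hl rmorph1.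
have [h hh] := rmorphism_of hD hM h1.
by exists h => a; rewrite hh; apply: hlp; rewrite hl.
Qed.

(** * Prime ideals and local rings *)

(** [S] is an arbitrary set: a multiplicative one leads to prime ideals, and [S = {1}] to maximal
    ideals. *)
Lemma maximal_disjoint_ideal (A : comUnitRingType) (I S : A -> Prop) :
  is_ideal I -> (forall x, I x -> ~ S x) ->
  exists P, [/\ is_ideal P, forall x, I x -> P x, forall x, P x -> ~ S x &
    forall N, is_ideal N -> (forall x, P x -> N x) -> (forall x, N x -> ~ S x) ->
      forall x, N x -> P x].
Proof.
move=> hI hIS.
(* Zorn runs over sets [X] whose union with [I] is an ideal, so that the empty chain is covered by
   [I] itself. *)
pose ok (X : set A) := is_ideal (fun x => I x \/ X x) /\ forall x, X x -> ~ S x.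
have [F hF tF|P [[hP hPS] maxP]] := @Zorn_bigcup A ok.
  pose U x := exists2 X, F X & X x.
  split; last by move=> x [X FX Xx]; exact: (hF X FX).2.
  have [I0 [ID IM]] := hI.
  split; first by left.
  split; last first.
    move=> r x [Ix|[X FX Xx]]; first by left; exact: IM.
    have [[_ [_ h]] _] := hF X FX.
    by case: (h r x (or_intror Xx)) => ?; [left | right; exists X].
  have half x y : I x -> U y -> I (x + y) \/ U (x + y).
    move=> Ix [X FX Xy]; have [[_ [h _]] _] := hF X FX.
    by case: (h x y (or_introl Ix) (or_intror Xy)) => ?; [left | right; exists X].
  move=> x y [Ix|Ux] [Iy|Uy].
  - by left; exact: ID.
  - exact: half.
  - by rewrite addrC; exact: half.
  - have [X FX Xx] := Ux; have [Y FY Yy] := Uy.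
    have [Z [FZ Zx Zy]] : exists Z, [/\ F Z, Z x & Z y].
      case: (tF X Y FX FY) => h; first by exists Y; split => //; exact: h.
      by exists X; split => //; exact: h.
    have [[_ [h _]] _] := hF Z FZ.
    by case: (h x y (or_intror Zx) (or_intror Zy)) => ?; [left | right; exists Z].
exists (fun x => I x \/ P x); split => //.
- by move=> x; left.
- by move=> x [Ix|Px]; [exact: hIS | exact: hPS].
- move=> N hN hPN hNS x Nx; apply: contrapT => hx.
  apply: (maxP N).
    split; first by move=> y Py; apply: hPN; right.
    by move=> h; apply: hx; right; exact: h.
  split=> //; have -> : (fun x => I x \/ N x) = N; last by [].
  apply: funext => y; apply: propext; split; last by right.
  by move=> [Iy|//]; apply: hPN; left.
Qed.

Definition mult_closed (A : comUnitRingType) (S : A -> Prop) :=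
  S 1 /\ forall x y, S x -> S y -> S (x * y).

Lemma ideal_adjoin (A : comUnitRingType) (P : A -> Prop) a :
  is_ideal P -> is_ideal (fun x => exists p c, P p /\ x = p + c * a).
Proof.
move=> [P0 [PD PM]]; split; [|split].
- by exists 0, 0; rewrite mul0r addr0.
- move=> x y [p [c [Pp ->]]] [q [d [Pq ->]]]; exists (p + q), (c + d).
  by split; [exact: PD | ring].
- move=> r x [p [c [Pp ->]]]; exists (r * p), (r * c).
  by split; [exact: PM | ring].
Qed.

Lemma prime_disjoint (A : comUnitRingType) (I S : A -> Prop) :
  is_ideal I -> mult_closed S -> (forall x, I x -> ~ S x) ->
  exists P, [/\ prime_ideal P, forall x, I x -> P x & forall x, P x -> ~ S x].
Proof.
move=> hI [S1 SM] hIS.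
have [P [hP IP PS maxP]] := maximal_disjoint_ideal hI hIS.
exists P; split => //; split => //; split; first by move=> /PS; apply.
have [P0 [PD PM]] := hP.
have meet a : ~ P a -> exists p c, P p /\ S (p + c * a).
  move=> nPa; apply: contrapT => h; apply: nPa.
  apply: (maxP _ (ideal_adjoin a hP)) => [x Px|x [p [c [Pp ->]]] Sx|].
  - by exists x, 0; rewrite mul0r addr0.
  - by apply: h; exists p, c.
  - by exists 0, 1; rewrite mul1r add0r.
move=> a b Pab; apply: contrapT => /not_orP[/meet [p [c [Pp Sa]]] /meet [q [d [Pq Sb]]]].
apply: (PS _ _ (SM _ _ Sa Sb)).
rewrite (_ : _ * _ = (q + d * b) * p + (c * a * q + (c * d) * (a * b))); last by ring.
apply: (PD); first exact: PM.
by apply: (PD); exact: PM.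
Qed.

Lemma ideal_principal (A : comUnitRingType) (s : A) : is_ideal (fun x => exists c, x = s * c).
Proof.
split; first by exists 0; rewrite mulr0.
split; first by move=> x y [c ->] [d ->]; exists (c + d); rewrite mulrDr.
by move=> r x [c ->]; exists (r * c); ring.
Qed.

(** Locality in the form that the nonunits are closed under addition; this form passes easily to
    surjective images. *)
Definition localr (A : comUnitRingType) :=
  forall x y : A, x + y \is a GRing.unit -> x \is a GRing.unit \/ y \is a GRing.unit.

Lemma unit_of (A : comUnitRingType) (x y : A) : x * y = 1 -> x \is a GRing.unit.
Proof. by move=> h; apply/unitrP; exists y; rewrite mulrC h. Qed.

Lemma nonunitM (A : comUnitRingType) (x y : A) :
  x \isn't a GRing.unit -> x * y \isn't a GRing.unit.
Proof. by rewrite unitrM negb_and => ->. Qed.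

Lemma nonunitD (A : comUnitRingType) (x y : A) : localr A ->
  x \isn't a GRing.unit -> y \isn't a GRing.unit -> x + y \isn't a GRing.unit.
Proof. by move=> hA /negP hx /negP hy; apply/negP => /hA[]. Qed.

Lemma nonunitN (A : comUnitRingType) (x : A) :
  x \isn't a GRing.unit -> - x \isn't a GRing.unit.
Proof. by rewrite unitrN. Qed.

Lemma unitD_nonunit (A : comUnitRingType) (x y : A) : localr A ->
  x \is a GRing.unit -> y \isn't a GRing.unit -> x + y \is a GRing.unit.
Proof.
move=> hA hx hy; apply: contraT => h.
by have := nonunitD hA h (nonunitN hy); rewrite addrK hx.
Qed.

Lemma unit1B (A : comUnitRingType) (x : A) : localr A ->
  x \isn't a GRing.unit -> 1 - x \is a GRing.unit.
Proof. by move=> hA hx; apply: unitD_nonunit; rewrite ?unitr1 ?unitrN. Qed.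

Lemma prime_nonunit (A : comUnitRingType) (P : A -> Prop) x :
  prime_ideal P -> P x -> x \isn't a GRing.unit.
Proof.
move=> [[_ [_ PM]] [P1 _]] Px; apply/negP => /unitrP [y [yx _]].
by apply: P1; rewrite -yx; exact: PM.
Qed.

Lemma prime_nonunits (A : comUnitRingType) :
  localr A -> prime_ideal (fun x : A => x \isn't a GRing.unit).
Proof.
move=> hA; split; first split; [|split|].
- by rewrite unitr0.
- by move=> x y; exact: nonunitD.
- by move=> r x; rewrite mulrC; exact: nonunitM.
- split; first by rewrite unitr1.
  by move=> a b; rewrite unitrM negb_and => /orP.
Qed.

Definition no_prime_chain (A : comUnitRingType) :=
  ~ (exists P0 P1 P2 : A -> Prop, prime_ideal P0 /\ prime_ideal P1 /\ prime_ideal P2 /\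
        strict_subset P0 P1 /\ strict_subset P1 P2).

(* If no power of [r] lies in [sA], some prime [P1] contains [s] but not [r]; since [s]
   is a nonzerodivisor, a strictly smaller prime avoids [s], giving a chain of length two. *)
Lemma nonzerodivisor_dvd_pow (A : comUnitRingType) (s r : A) :
  localr A -> no_prime_chain A -> nonzerodivisor s -> r \isn't a GRing.unit ->
  exists j c, r ^+ j = s * c.
Proof.
move=> hA hch hs hr; apply: contrapT => hno; apply: hch.
have [P1 [pP1 sP1 rP1]] := @prime_disjoint A _ (fun x => exists j, x = r ^+ j)
  (ideal_principal s) (conj (ex_intro _ 0%N (esym (expr0 r)))
    (fun x y '(ex_intro i hi) '(ex_intro j hj) =>
       ex_intro _ (i + j)%N (etrans (congr2 *%R hi hj) (esym (exprD r i j)))))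
  (fun x '(ex_intro c hc) '(ex_intro j hj) => hno (ex_intro _ j (ex_intro _ c (etrans (esym hj) hc)))).
have [[P10 [P1D P1M]] [P11 P1p]] := pP1.
(* Avoiding all [s ^+ i * t] with [t] outside [P1] does two things at once: [i = 0] puts [P0] inside
   [P1], and [t = 1] keeps [s] out of [P0]. Zero is not of this form because [s] is a
   nonzerodivisor. *)
have hS : mult_closed (fun x => exists i t, ~ P1 t /\ x = s ^+ i * t).
  split; first by exists 0%N, 1; rewrite expr0 mul1r.
  move=> x y [i [t [ht ->]]] [j [u [hu ->]]]; exists (i + j)%N, (t * u).
  by split; [move=> /P1p[] | rewrite exprD; ring].
have h0 : is_ideal (fun x : A => x = 0).
  split=> //; split; first by move=> x y -> ->; rewrite addr0.
  by move=> a x ->; rewrite mulr0.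
have [P0 [pP0 _ P0S]] := prime_disjoint h0 hS
  (fun x (hx : x = 0) '(ex_intro i (ex_intro t (conj ht e))) =>
     ht (eq_ind_r P1 P10 (@nonzerodivisorX A s i hs t (etrans (esym e) hx)))).
exists P0, P1, (fun x => x \isn't a GRing.unit); split=> //; split=> //.
split; first exact: prime_nonunits.
split; split.
- move=> x P0x; apply: contrapT => nx; apply: (P0S x P0x).
  by exists 0%N, x; rewrite expr0 mul1r.
- exists s; split; first by apply: sP1; exists 1; rewrite mulr1.
  by move=> /P0S; apply; exists 1%N, 1; rewrite expr1 mulr1.
- by move=> x; exact: prime_nonunit.
- by exists r; split => // /rP1; apply; exists 1%N; rewrite expr1.
Qed.

(** A nonunit generates a proper ideal, hence lies in some maximal ideal, which is [M] by
    uniqueness. From here on [M] is represented by the nonunits. *)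
Lemma maximal_ideal_nonunits (A : comUnitRingType) (M : A -> Prop) :
  maximal_ideal M ->
  (forall N, maximal_ideal N -> forall x, N x <-> M x) ->
  forall x, M x <-> x \isn't a GRing.unit.
Proof.
move=> [[M0 [MD MM]] [M1 _]] hloc x; split.
  move=> Mx; apply/negP => /unitrP [y [yx _]].
  by apply: M1; rewrite -yx; exact: MM.
move=> /negP hx.
have [N [hN xN NS maxN]] := @maximal_disjoint_ideal A _ (fun y => y = 1)
  (ideal_principal x) (fun y '(ex_intro c hc) hy1 => hx (unit_of (etrans (esym hc) hy1))).
suff: maximal_ideal N.
  by move=> mN; apply/(hloc N mN)/xN; exists 1; rewrite mulr1.
  split=> //; split; first by move=> /NS; apply.
  move=> N' hN' NN'; case: (pselect (N' 1)) => [|h]; [by right | left => y].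
  split; last exact: NN'.
  by apply: maxN => // z N'z z1; apply: h; rewrite -z1.
Qed.

(** * From the square-zero prime of the completion to stability *)

Lemma integral_quadratic (A Q : comUnitRingType) (f : {rmorphism A -> Q}) x a b :
  x * x = f a * x + f b -> integral_over f x.
Proof.
move=> hx; exists (('X - a%:P) * 'X - b%:P); split; last first.
  rewrite rmorphB rmorphM rmorphB /= map_polyX !map_polyC /= rootE !hornerE.
  by rewrite mulrBl hx; apply/eqP; ring.
have mon : ('X - a%:P) * 'X \is monic by rewrite monicMr ?monicX // monicXsubC.
rewrite monicE lead_coefDl; first by rewrite -monicE.
rewrite size_polyN (leq_ltn_trans (size_polyC_leq1 b)) //.
rewrite size_Mmonic ?monicX ?size_polyX ?size_XsubC //.
by rewrite monic_neq0 ?monicXsubC.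
Qed.

Lemma nonzerodivisor_dvd (A : comUnitRingType) (x y : A) :
  nonzerodivisor (x * y) -> nonzerodivisor x.
Proof. by move=> h z hz; apply: h; rewrite mulrAC hz mul0r. Qed.

Section Completion.
Variables (A T : comUnitRingType) (m : A) (h : {rmorphism A -> T}).
Hypotheses (hc : adic_completion m h) (hA : localr A).
Hypotheses (hm : nonzerodivisor m) (hmu : m \isn't a GRing.unit).

Lemma completion_approx i t : exists r u, t = h r + h m ^+ i * u.
Proof. exact: hc.1. Qed.

Lemma completion_dvd i r u : h r = h m ^+ i * u -> exists r', r = m ^+ i * r'.
Proof. by move=> e; apply: hc.2.1; exists u. Qed.

Lemma completion_sep t : (forall i, exists u, t = h m ^+ i * u) -> t = 0.
Proof. exact: hc.2.2.1. Qed.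

Lemma completion_eq x y i u : h x = h y + h m ^+ i * u -> exists r, x = y + m ^+ i * r.
Proof.
move=> e; have [r hr] : exists r, x - y = m ^+ i * r.
  by apply: (@completion_dvd _ _ u); rewrite rmorphB e; ring.
by exists r; rewrite -hr addrC subrK.
Qed.

(** Nakayama by hand: [1 - m * r] is a unit, so a divisibility of [m ^+ i] by [x] that holds modulo
    one further power of [m] is exact. It brings divisibilities found in the completion back to
    [A]. *)
Lemma dvd_unit1 i x c r : m ^+ i = x * c + m ^+ i.+1 * r -> exists d, m ^+ i = x * d.
Proof.
have u : 1 - m * r \is a GRing.unit by apply: unit1B => //; exact: nonunitM.
move=> e; exists (c * (1 - m * r)^-1).
rewrite mulrA; apply: (mulIr u); rewrite mulrVK //.
by rewrite mulrBr mulr1 {1}e exprSr; ring.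
Qed.

Variables (P : T -> Prop) (D : comUnitRingType) (psi : {rmorphism T -> D}).
Hypotheses (hP2 : forall x y, P x -> P y -> x * y = 0).
Hypotheses (hpsi : forall d, exists t, psi t = d) (kpsi : forall t, psi t = 0 <-> P t).
Hypothesis hD : is_DVR D.

Lemma ker_sqr0 x y : psi x = 0 -> psi y = 0 -> x * y = 0.
Proof. by move=> /kpsi hx /kpsi hy; exact: hP2. Qed.

(* As [ker psi] has square zero, divisibility modulo [ker psi] can be lifted by squaring. *)
Lemma dvd_pow_of_residue a : psi (h a) <> 0 -> exists j c, m ^+ j = a * c.
Proof.
move=> ha; have [D1 [Ddom [v [vM [vD [_ vdvd]]]]]] := hD.
have v1 : v 1 = 0%N.
  by have /eqP := vM 1 1 D1 D1; rewrite mulr1 -{1}[v 1]addn0 eqn_add2l eq_sym => /eqP.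
have g0 : psi (h m) != 0.
  apply/eqP => g0; have := ker_sqr0 g0 g0; rewrite -rmorphM => h0.
  have [r hr] : exists r, m * m = m ^+ 3 * r by apply: (@completion_dvd _ _ 0); rewrite h0 mulr0.
  have : m * m * (1 - m * r) = 0 by rewrite mulrBr mulr1 {1}hr; ring.
  move=> /(nonzerodivisorM hm hm) e.
  by have := unit1B hA (nonunitM r hmu); rewrite e unitr0.
have vg : (0 < v (psi (h m)))%N.
  rewrite lt0n; apply/eqP => vg0.
  have [z hz] : exists z, 1 = z * psi (h m) by apply: vdvd; rewrite ?vg0 ?v1.
  have [z' zz'] := hpsi z.
  have k0 : psi (1 - z' * h m) = 0 by rewrite rmorphB rmorph1 rmorphM zz' -hz subrr.
  (* One Newton step: [z'] inverts [h m] modulo the kernel, and since [(1 - z' * h m) ^+ 2 = 0], the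
     corrected [w] is a true inverse. *)
  have := ker_sqr0 k0 k0; pose w := z' * (2 - h m * z') => e.
  have e1 : 1 = h m * w by apply/eqP; rewrite -subr_eq0; apply/eqP; rewrite -e /w; ring.
  have [r hr] : exists r, 1 = m ^+ 1 * r by apply: (@completion_dvd _ _ w); rewrite rmorph1 expr1.
  by move: hmu; rewrite (@unit_of _ m r) // -(expr1 m).
have gX n : psi (h m) ^+ n != 0.
  elim: n => [|n ih]; first by rewrite expr0.
  by rewrite exprS; apply/eqP => /Ddom[] /eqP; [rewrite (negPf g0) | rewrite (negPf ih)].
have vX n : (n <= v (psi (h m) ^+ n))%N.
  elim: n => [//|n ih]; rewrite exprS vM //.
  by rewrite -add1n; exact: leq_add.
set n := v (psi (h a)).
have [z hz] : exists z, psi (h m) ^+ n = z * psi (h a).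
  by apply: vdvd; [exact/eqP | exact: gX | exact: vX].
have [z' zz'] := hpsi z.
pose p := h m ^+ n - z' * h a.
have p0 : psi p = 0 by rewrite /p rmorphB rmorphXn rmorphM zz' hz subrr.
(* Multiplying [h m ^+ n - p] by its conjugate [h m ^+ n + p] removes [p], as [p * p = 0]; the price
   is the doubled exponent. *)
have e : h m ^+ (n + n) = h a * (z' * (h m ^+ n + p)).
  have e1 : z' * h a = h m ^+ n - p by rewrite /p; ring.
  transitivity ((z' * h a) * (h m ^+ n + p)); last by ring.
  rewrite e1 exprD; transitivity (h m ^+ n * h m ^+ n - p * p); last by ring.
  by rewrite (ker_sqr0 p0 p0) subr0.
(* The precision exceeds the exponent by one, as [dvd_unit1] requires. *)
have [r [u hu]] := completion_approx (n + n).+1 (z' * (h m ^+ n + p)).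
have [s hs] : exists s, m ^+ (n + n) = a * r + m ^+ (n + n).+1 * s.
  apply: (@completion_eq _ _ _ (h a * u)).
  by rewrite rmorphXn e hu rmorphM; ring.
by have [d hd] := dvd_unit1 hs; exists (n + n)%N, d.
Qed.

Hypothesis dvdm : forall s, nonzerodivisor s -> exists j c, m ^+ j = s * c.

Lemma psi_pow j : psi (h (m ^+ j)) <> 0.
Proof.
move=> p0.
have h0 : h (m ^+ j * m ^+ j) = 0 by rewrite rmorphM (ker_sqr0 p0 p0).
have [r hr] : exists r, m ^+ j * m ^+ j = m ^+ (j + j).+1 * r.
  by apply: (@completion_dvd _ _ 0); rewrite h0 mulr0.
have : m ^+ (j + j) * (1 - m * r) = 0 by rewrite mulrBr mulr1 exprD {1}hr exprS exprD; ring.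
move=> /(@nonzerodivisorX _ m (j + j) hm) e.
by have := unit1B hA (nonunitM r hmu); rewrite e unitr0.
Qed.

(** The least value is taken over the elements of [I] with nonzero residue; a power of [m] in [I] is
    one. Modulo the kernel, [b] and [c] are multiples [tb * a] and [tc * a], and the product of the
    two differences vanishes, which exhibits [b * c] as [a] times a combination of [a], [b], [c]
    with coefficients in [T]. *)
Lemma ideal_square (I : A -> Prop) : is_ideal I -> regular_ideal I ->
  exists a, [/\ I a, nonzerodivisor a &
    forall b c, I b -> I c -> exists d, I d /\ b * c = a * d].
Proof.
move=> [I0 [ID IM]] [s [Is hs]].
have [_ [_ [v [_ [_ [_ vdvd]]]]]] := hD.
have [l [c0 hl]] := dvdm hs.
have Il : I (m ^+ l) by rewrite hl mulrC; exact: IM.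
pose Pn n := `[< exists a, [/\ I a, psi (h a) <> 0 & v (psi (h a)) = n] >].
have exP : exists n, Pn n.
  by exists (v (psi (h (m ^+ l)))); apply/asboolP; exists (m ^+ l); split => //; exact: psi_pow.
case: (ex_minnP exP) => n /asboolP [a [Ia ha va]] minn.
have [j [w hw]] := dvd_pow_of_residue ha.
exists a; split => //.
  by apply: (@nonzerodivisor_dvd _ a w); rewrite -hw; exact: nonzerodivisorX.
have dvda b : I b -> exists t, psi (h b - t * h a) = 0.
  move=> Ib; case: (pselect (psi (h b) = 0)) => hb.
    by exists 0; rewrite mul0r subr0.
  have [z hz] : exists z, psi (h b) = z * psi (h a).
    apply: vdvd; [exact/eqP | exact/eqP |].
    by rewrite va; apply: minn; apply/asboolP; exists b.
  have [t ht] := hpsi z.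
  by exists t; rewrite rmorphB rmorphM ht hz subrr.
move=> b c Ib Ic.
have [tb htb] := dvda b Ib; have [tc htc] := dvda c Ic.
have e : h b * h c = h a * (tb * h c + tc * h b - tb * tc * h a).
  apply/eqP; rewrite -subr_eq0; apply/eqP.
  by rewrite -(ker_sqr0 htb htc); ring.
(* The coefficients are moved into [A] with error [m ^+ (j + l)]: the factor [m ^+ j] is a multiple
   of [a], and [m ^+ l] keeps the quotient inside [I]. *)
have [rb [ub hub]] := completion_approx (j + l) tb.
have [rc [uc huc]] := completion_approx (j + l) tc.
have [x hx] : exists x, b * c = a * (rb * c + rc * b - rb * rc * a) + m ^+ (j + l) * x.
  apply: (@completion_eq _ _ _ (h a * (ub * h c + uc * h b - (ub * tc + h rb * uc) * h a))).
  rewrite !(rmorphM, rmorphD, rmorphB) e {1}hub {1}huc.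
  have -> : ub * tc = ub * (h rc + h m ^+ (j + l) * uc) by rewrite huc.
  by rewrite hub huc; ring.
exists (rb * c + rc * b - rb * rc * a + w * x * m ^+ l); split.
  apply: (ID); last exact: IM.
  apply: (ID); first by apply: (ID); exact: IM.
  by rewrite -mulNr; exact: IM.
by rewrite hx exprD hw; ring.
Qed.

Lemma stable_of_completion : stable_ring A.
Proof.
move=> Q f [finj [funit _]] I hI hreg.
have [a [Ia ha sq]] := ideal_square hI hreg.
have ua := funit a ha.
exists unit, (fun=> f a), (fun _ y => y / f a); split; last split; last split; last split.
- by move=> _; exists a.
- move=> _ _ [b [Ib ->]] _ [c [Ic ->]].
  have [d [Id hd]] := sq b c Ib Ic; exists d; split => //.
  by rewrite mulrAC -rmorphM hd rmorphM mulrAC divrr ?mul1r.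
- by move=> _ y z _ _; rewrite mulrDl.
- by move=> _ e y _ _; rewrite mulrA.
- move=> y _; exists [:: tt]; split => //; split; first by case.
  by rewrite big_seq1 divrK.
Qed.

Lemma common_denominator (Q : comUnitRingType) (f : {rmorphism A -> Q}) (s : seq Q) :
  total_quotient f -> exists k, forall x, x \in s -> exists a, f m ^+ k * x = f a.
Proof.
move=> [_ [_ fden]]; elim: s => [|q s [k ih]]; first by exists 0%N.
have [a [d [hd e]]] := fden q; have [j [c hj]] := dvdm hd.
exists (j + k)%N => x; rewrite inE => /orP[/eqP->|/ih [b hb]].
  exists (m ^+ k * c * a); rewrite !rmorphM -e exprD -!rmorphXn hj rmorphM; ring.
by exists (m ^+ j * b); rewrite exprD -mulrA hb rmorphM rmorphXn.
Qed.

Lemma not_finite_of_completion : (exists p, P p /\ p <> 0) -> ~ finite_integral_closure A.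
Proof.
move=> [p [Pp p0]] fin.
have [Q [f hQ]] := total_quotient_exists A.
have [gens [_ hgens]] := fin Q f hQ.
have [finj [funit _]] := hQ.
have [k hk] := common_denominator gens hQ.
have hk' q : integral_over f q -> exists a, f m ^+ k * q = f a.
  move=> /hgens [cs [_ ->]].
  rewrite mulr_sumr; elim/big_ind: _ => [|x y [a ->] [b ->]|i _].
  - by exists 0; rewrite rmorph0.
  - by exists (a + b); rewrite rmorphD.
  - have [a ha] := hk gens`_i (mem_nth 0 (ltn_ord i)).
    by exists (cs`_i * a); rewrite mulrCA ha rmorphM.
have [j hj] : exists j, ~ exists u, p = h m ^+ j * u.
  by apply: contrapT => /forallNP no; apply: p0; apply: completion_sep => j; exact: contrapT.
(* [m ^+ k] clears the denominators of all integral elements, and [m ^+ j] does not divide [p].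
   Approximating [p] to precision [n + n] makes [r / m ^+ n] integral; clearing by [m ^+ k] leaves
   [m ^+ j] as a divisor of [r], hence of [p]. *)
pose n := (k + j)%N.
have [r [u hu]] := completion_approx (n + n) p.
have pp : p * p = 0 by exact: hP2.
have [r' hr'] : exists r', r * r = m ^+ (n + n) * r'.
  apply: (@completion_dvd _ _ (- (2 * p * u) + h m ^+ (n + n) * u * u)).
  have -> : h (r * r) = p * p - 2 * p * (h m ^+ (n + n) * u) + (h m ^+ (n + n) * u) ^+ 2.
    by rewrite hu rmorphM; ring.
  by rewrite pp; ring.
have um i : f m ^+ i \is a GRing.unit by rewrite unitrX // funit.
have [a ha] : exists a, f m ^+ k * (f r / f m ^+ n) = f a.
  apply: hk'; apply: (@integral_quadratic _ _ _ _ 0 r'); rewrite rmorph0 mul0r add0r.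
  rewrite mulrACA -rmorphM hr' -invrM ?um // -exprD rmorphM rmorphXn.
  by rewrite mulrAC divrr ?um // mul1r.
have : r = m ^+ j * a.
  apply: finj; rewrite rmorphM -ha rmorphXn mulrA -exprD addnC -/n.
  by rewrite mulrC divrK ?um.
move=> e; apply: hj; exists (h a + h m ^+ (k + n) * u).
rewrite {1}hu e rmorphM rmorphXn mulrDr mulrA -exprD; congr (_ + h m ^+ _ * _).
by rewrite /n; ring.
Qed.

End Completion.

(** * Invertible modules and integral elements *)

Section IntegralClosure.
Variables (A Q : comUnitRingType) (f : {rmorphism A -> Q}).

Lemma integral_overP x : integral_over f x <-> integralOver f x.
Proof. by split=> [[p [h1 h2]]|[p h1 h2]]; exists p. Qed.

Lemma integral_overD x y : integral_over f x -> integral_over f y -> integral_over f (x + y).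
Proof. by move=> /integral_overP hx /integral_overP hy; apply/integral_overP; exact: integral_add. Qed.

Lemma integral_overB x y : integral_over f x -> integral_over f y -> integral_over f (x - y).
Proof. by move=> /integral_overP hx /integral_overP hy; apply/integral_overP; exact: integral_sub. Qed.

Lemma integral_overM x y : integral_over f x -> integral_over f y -> integral_over f (x * y).
Proof. by move=> /integral_overP hx /integral_overP hy; apply/integral_overP; exact: integral_mul. Qed.

Lemma integral_over_base a : integral_over f (f a).
Proof. by apply/integral_overP; exact: integral_id. Qed.

Lemma integral_over0 : integral_over f 0.
Proof. by rewrite -(rmorph0 f); exact: integral_over_base. Qed.

Lemma integral_over1 : integral_over f 1.
Proof. by rewrite -(rmorph1 f); exact: integral_over_base. Qed.

Lemma integral_overX x n : integral_over f x -> integral_over f (x ^+ n).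
Proof.
move=> hx; elim: n => [|n ih]; first by rewrite expr0; exact: integral_over1.
by rewrite exprS; exact: integral_overM.
Qed.

Lemma integral_over_quadratic_span x : (exists a b, x * x = f a + f b * x) -> integral_over f x.
Proof. by move=> [a [b e]]; apply: (@integral_quadratic _ _ _ _ b a); rewrite e addrC. Qed.

Definition submodule (N : Q -> Prop) :=
  [/\ N 0, forall x y, N x -> N y -> N (x + y) & forall a x, N x -> N (f a * x)].

Definition stabilizer (N : Q -> Prop) (q : Q) := forall w, N w -> N (q * w).

Lemma stabilizer_base N a : submodule N -> stabilizer N (f a).
Proof. by move=> [_ _ NM] w; exact: NM. Qed.

Lemma stabilizer0 N : submodule N -> stabilizer N 0.
Proof. by move=> /(stabilizer_base 0); rewrite rmorph0. Qed.

Lemma stabilizer1 N : stabilizer N 1.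
Proof. by move=> w; rewrite mul1r. Qed.

Lemma stabilizerD N x y : submodule N -> stabilizer N x -> stabilizer N y -> stabilizer N (x + y).
Proof. by move=> [_ ND _] hx hy w Nw; rewrite mulrDl; apply: ND; [exact: hx | exact: hy]. Qed.

Lemma stabilizerM N x y : stabilizer N x -> stabilizer N y -> stabilizer N (x * y).
Proof. by move=> hx hy w Nw; rewrite -mulrA; apply/hx/hy. Qed.

Lemma stabilizerN N x : submodule N -> stabilizer N x -> stabilizer N (- x).
Proof.
move=> hN hx; rewrite -mulN1r -(rmorph1 f) -rmorphN.
by apply: stabilizerM => //; exact: stabilizer_base.
Qed.

Lemma stabilizerX N x n : stabilizer N x -> stabilizer N (x ^+ n).
Proof.
move=> hx; elim: n => [|n ih]; first by rewrite expr0; exact: stabilizer1.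
by rewrite exprS; exact: stabilizerM.
Qed.

(* A finitely supported dual basis: [N] is an invertible module over its stabilizer. *)
Definition invertible_module (N : Q -> Prop) := exists s : seq (Q * Q),
  (forall p, p \in s -> N p.2 /\ forall w, N w -> stabilizer N (p.1 * w)) /\
  \sum_(p <- s) p.1 * p.2 = 1.

(** The dual basis sums to [1], so its terms cannot all lie in an additively closed [S] missing [1].
    When [S] is the set of nonunits of a local ring, the chosen product is a unit there and [g]
    becomes a generator; this stands in for localization. *)
Lemma invertible_pick (N S : Q -> Prop) :
  S 0 -> (forall x y, S x -> S y -> S (x + y)) -> ~ S 1 -> invertible_module N ->
  exists q g, [/\ N g, forall w, N w -> stabilizer N (q * w) & ~ S (q * g)].
Proof.
move=> S0 SD S1 [s [hs e]]; apply: contrapT => no; apply: S1; rewrite -e big_seq.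
elim/big_ind: _ => // p ps; apply: contrapT => nS; apply: no.
by have [h1 h2] := hs p ps; exists p.1, p.2.
Qed.

(* Clearing denominators in an integral equation of [g] by powers of [q]. *)
Lemma integral_clear N q g : submodule N -> stabilizer N q -> stabilizer N (q * g) ->
  integral_over f g -> exists n, stabilizer N ((q * g) ^+ n * g).
Proof.
move=> hN hq hqg [p [mp rp]].
have : (map_poly f p).[g] = 0 by exact/rootP.
rewrite horner_coef size_map_poly_id0; last first.
  by rewrite (monicP mp) rmorph1 oner_neq0.
have : (0 < size p)%N by rewrite size_poly_gt0 monic_neq0.
case sp: (size p) => [//|n] _.
rewrite big_ord_recr /= coef_map /=.
have -> : p`_n = 1 by have := monicP mp; rewrite lead_coefE sp.
rewrite rmorph1 mul1r => /eqP; rewrite addrC addr_eq0 => /eqP e.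
case: n sp e => [|n] sp e.
  by move: e; rewrite big_ord0 oppr0 expr0 => /eqP; rewrite oner_eq0.
exists n; rewrite exprMn -mulrA -exprSr e mulrN; apply: stabilizerN => //.
rewrite mulr_sumr; elim/big_ind: _ => [|x y|i _].
- exact: stabilizer0.
- exact: stabilizerD.
- rewrite coef_map /= mulrCA; apply: stabilizerM; first exact: stabilizer_base.
  have -> : q ^+ n = q ^+ (n - i) * q ^+ i by rewrite -exprD subnK // -ltnS.
  rewrite -mulrA -exprMn.
  by apply: stabilizerM; exact: stabilizerX.
Qed.

(* Locally at a prime of its stabilizer [B], an invertible [N] containing [1] is generated
   by an element which is integral over [B] and has its inverse in [B], so that [N = B]. *)
Lemma invertible_integral_ring N : submodule N -> N 1 -> (forall x, N x -> integral_over f x) ->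
  invertible_module N -> forall x y, N x -> N y -> N (x * y).
Proof.
move=> hN N1 NI [s [hs e]] x y Nx; move: y; rewrite -/(stabilizer N x).
(* [K] is the ideal of the stabilizer carrying [N] into the stabilizer, and [R] is its radical. By
   [integral_clear] every term of the dual basis lies in [R], hence so does their sum [1], which
   means that [N] is contained in its stabilizer. *)
pose K b := forall w, N w -> stabilizer N (b * w).
have K0 : K 0 by move=> w _; rewrite mul0r; exact: stabilizer0.
have KD a b : K a -> K b -> K (a + b).
  by move=> ha hb w Nw; rewrite mulrDl; apply: stabilizerD; [|exact: ha|exact: hb].
have KM a b : stabilizer N a -> K b -> K (a * b).
  by move=> ha hb w Nw; rewrite -mulrA; apply: stabilizerM; [|exact: hb].
have KMn a n : K a -> K (a *+ n).
  by move=> ha; elim: n => [|n ih]; rewrite ?mulr0n // mulrS; exact: KD.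
pose R b := stabilizer N b /\ exists n, K (b ^+ n).
have R0 : R 0 by split; [exact: stabilizer0 | exists 1%N; rewrite expr1].
have RD a b : R a -> R b -> R (a + b).
  move=> [ha [n Kn]] [hb [k Kk]]; split; first exact: stabilizerD.
  exists (n + k)%N; rewrite exprDn; elim/big_ind: _ => // i _; apply: KMn.
  case: (leqP k i) => hi.
    by rewrite -(subnK hi) exprD mulrA; apply: KM => //; apply: stabilizerM; exact: stabilizerX.
  have hn : (n <= n + k - i)%N by rewrite -addnBA ?leq_addr // ltnW.
  rewrite -(subnK hn) exprD mulrC mulrA; apply: KM => //.
  by apply: stabilizerM; exact: stabilizerX.
have [_ [n]] : R 1.
  rewrite -e big_seq; elim/big_ind: _ => // p ps.
  have [Np2 hp] := hs p ps.
  have Bq : stabilizer N p.1 by rewrite -[p.1]mulr1; exact: hp.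
  have Bu := hp _ Np2; split=> //.
  have [n hn] := integral_clear hN Bq Bu (NI _ Np2).
  exists n.+1 => w Nw; rewrite exprSr (_ : _ * w = (p.1 * p.2) ^+ n * p.2 * (p.1 * w)).
    by apply: stabilizerM => //; exact: hp.
  by ring.
by rewrite expr1n => /(_ x Nx); rewrite mul1r.
Qed.

Definition span2 x y q := exists a b c, q = f a + f b * x + f c * y.

Lemma span2_submodule x y : submodule (span2 x y).
Proof.
split.
- by exists 0, 0, 0; rewrite !rmorph0; ring.
- move=> _ _ [a [b [c ->]]] [a' [b' [c' ->]]].
  by exists (a + a'), (b + b'), (c + c'); rewrite !rmorphD; ring.
- move=> r _ [a [b [c ->]]]; exists (r * a), (r * b), (r * c).
  by rewrite !rmorphM; ring.
Qed.

Lemma span2_base x y a : span2 x y (f a).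
Proof. by exists a, 0, 0; rewrite !rmorph0; ring. Qed.

Lemma span2_l x y : span2 x y x.
Proof. by exists 0, 1, 0; rewrite !rmorph0 rmorph1; ring. Qed.

Lemma span2_r x y : span2 x y y.
Proof. by exists 0, 0, 1; rewrite !rmorph0 rmorph1; ring. Qed.

(* [closure_max y]: [y] lies in the ideal of the integral closure generated by the nonunits of [A]. *)
Inductive closure_max : Q -> Prop :=
| closure_max0 : closure_max 0
| closure_max_cons a z y : a \isn't a GRing.unit -> integral_over f z ->
    closure_max y -> closure_max (f a * z + y).

Lemma closure_maxD x y : closure_max x -> closure_max y -> closure_max (x + y).
Proof.
move=> hx hy; elim: hx => [|a z x' ha hz _ ih]; first by rewrite add0r.
by rewrite -addrA; exact: closure_max_cons.
Qed.

Lemma closure_maxM x y : integral_over f x -> closure_max y -> closure_max (x * y).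
Proof.
move=> hx; elim=> [|a z y' ha hz _ ih]; first by rewrite mulr0; exact: closure_max0.
rewrite (_ : _ * _ = f a * (x * z) + x * y'); last by ring.
by apply: closure_max_cons => //; exact: integral_overM.
Qed.

Lemma closure_max_base a : a \isn't a GRing.unit -> closure_max (f a).
Proof.
move=> ha; rewrite (_ : f a = f a * 1 + 0); last by ring.
by apply: closure_max_cons => //; [exact: integral_over1 | exact: closure_max0].
Qed.

Lemma closure_maxN x : closure_max x -> closure_max (- x).
Proof.
move=> h; rewrite -mulN1r -(rmorph1 f) -rmorphN.
by apply: closure_maxM => //; exact: integral_over_base.
Qed.

Lemma closure_maxB x y : closure_max x -> closure_max y -> closure_max (x - y).
Proof. by move=> hx hy; apply: closure_maxD => //; exact: closure_maxN. Qed.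

Lemma closure_max_integral x : closure_max x -> integral_over f x.
Proof.
elim=> [|a z y _ hz _ hy]; first exact: integral_over0.
by apply: integral_overD => //; apply: integral_overM => //; exact: integral_over_base.
Qed.

Lemma closure_maxMl x y : integral_over f x -> closure_max y -> closure_max (y * x).
Proof. by rewrite mulrC; exact: closure_maxM. Qed.

End IntegralClosure.

(** * The integral closure of a stable local ring *)

Section Stable.
Variables (A Q : comUnitRingType) (f : {rmorphism A -> Q}) (m : A).
Hypotheses (hA : localr A) (hm : nonzerodivisor m) (hmu : m \isn't a GRing.unit).
(* All that is used of dimension one. *)
Hypothesis nilp : forall s r : A, nonzerodivisor s -> r \isn't a GRing.unit ->
  exists j c, r ^+ j = s * c.
Hypotheses (hQ : total_quotient f) (hst : stable_ring A).

Let Ai := integral_over f.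
Let MA := closure_max f.

Let finj : injective f. Proof. exact: hQ.1. Qed.
Let um : f m \is a GRing.unit. Proof. exact: hQ.2.1. Qed.
Let umX k : f m ^+ k \is a GRing.unit. Proof. by rewrite unitrX. Qed.

Lemma dvdm s : nonzerodivisor s -> exists j c, m ^+ j = s * c.
Proof. by move=> hs; exact: nilp. Qed.

Definition fractional (N : Q -> Prop) := exists k, forall x, N x -> exists a, f m ^+ k * x = f a.

Lemma unit_reg a : f a \is a GRing.unit -> nonzerodivisor a.
Proof.
move=> ua x hx; apply: finj; apply: (mulrI ua).
by rewrite rmorph0 mulr0 -rmorphM hx rmorph0.
Qed.

(** A power of [m] scales [W] to a regular ideal [I] with the same stabilizer. The coordinate maps
    of a projective splitting turn out to be multiplications by elements of [Q], so the finite
    support of one unit [y0] serves all of [I], and dividing its expansion by [y0] gives the dual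
    basis. *)
Lemma stable_invertible W : submodule f W -> fractional W ->
  (exists w, W w /\ w \is a GRing.unit) -> invertible_module W.
Proof.
move=> hW [k hk] [w0 [Ww0 uw0]]; have [W0 WD WM] := hW.
pose d := f m ^+ k; have ud : d \is a GRing.unit := umX k.
pose I a := exists w, W w /\ f a = d * w.
have hI : is_ideal I.
  split; first by exists 0; rewrite rmorph0 mulr0.
  split; first by move=> x y [w [Ww e]] [w' [Ww' e']]; exists (w + w');
    rewrite rmorphD e e' mulrDr; split => //; exact: WD.
  by move=> r x [w [Ww e]]; exists (f r * w); rewrite rmorphM e; split; [exact: WM | ring].
have fracP y : frac_of f I (d * y) <-> W y.
  split; first by move=> [a [[w [Ww e]] e']]; move: e'; rewrite e => /(mulrI ud) ->.
  by move=> Wy; have [a ha] := hk y Wy; exists a; split; [exists y; rewrite ha | ].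
have fracP' y : frac_of f I y -> W (y / d) by move=> h; apply/fracP; rewrite mulrC divrK.
have endoP q : endo_ring f I q -> stabilizer W q.
  by move=> h w Ww; apply/fracP; rewrite mulrCA; apply: h; exact/fracP.
have endo_frac y : frac_of f I y -> endo_ring f I y.
  move=> [a [_ ->]] _ [b [Ib ->]]; exists (a * b); rewrite rmorphM; split => //.
  by have [_ [_ h]] := hI; exact: h.
have hreg : regular_ideal I.
  have [a [Ia ha]] := (fracP w0).2 Ww0; exists a; split => //.
  by apply: unit_reg; rewrite -ha unitrM ud.
have [X [g [phi [hg [hE [_ [hlin hs]]]]]]] := hst hQ hI hreg.
pose y0 := d * w0; have F0 : frac_of f I y0 by exact/fracP.
have uy0 : y0 \is a GRing.unit by rewrite unitrM ud.
(* Both [y] and [y0] lie in [I], hence in its endomorphism ring, so linearity evaluates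
   [phi x (y * y0)] in two ways. *)
have phiE x y : frac_of f I y -> phi x y = phi x y0 * y / y0.
  move=> Fy; apply: (mulIr uy0); rewrite divrK // [LHS]mulrC [RHS]mulrC -!hlin //.
  - by rewrite mulrC.
  - exact: endo_frac.
  - exact: endo_frac.
have [s [_ [_ es]]] := hs y0 F0.
exists [seq (phi x y0 / y0 * d, g x / d) | x <- s]; split.
  move=> _ /mapP [x xs ->] /=; split; first exact: fracP'.
  move=> w Ww; have Fw : frac_of f I (d * w) by exact/fracP.
  rewrite (_ : _ * w = phi x (d * w)); first by apply: endoP; exact: hE.
  by rewrite (phiE _ (d * w)) // -[LHS]mulrA mulrAC.
rewrite big_map; transitivity (\sum_(x <- s) phi x y0 * g x / y0).
  by apply: eq_bigr => x _ /=; rewrite -mulrA [d * _]mulrC divrK // mulrAC.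
by rewrite -mulr_suml -es divrr.
Qed.

Lemma denominator q : exists k a, f m ^+ k * q = f a.
Proof.
have [k hk] := common_denominator dvdm [:: q] hQ.
by exists k; apply: hk; rewrite inE.
Qed.

Lemma fractional_span2 x y : fractional (span2 f x y).
Proof.
have [k hk] := common_denominator dvdm [:: x; y] hQ.
have [a ha] := hk x (mem_head _ _).
have [b hb] : exists b, f m ^+ k * y = f b by apply: hk; rewrite !inE eqxx orbT.
exists k => _ [r [s [t ->]]]; exists (m ^+ k * r + s * a + t * b).
by rewrite !(rmorphD, rmorphM, rmorphXn) /= -ha -hb; ring.
Qed.

Lemma span2_invertible x y : invertible_module (span2 f x y).
Proof.
apply: stable_invertible; [exact: span2_submodule | exact: fractional_span2 |].
by exists 1; rewrite unitr1 -(rmorph1 f); split => //; exact: span2_base.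
Qed.

Lemma span2_integral x y q : Ai x -> Ai y -> span2 f x y q -> Ai q.
Proof.
move=> hx hy [a [b [c ->]]].
apply: integral_overD; last by apply: integral_overM => //; exact: integral_over_base.
apply: integral_overD; first exact: integral_over_base.
by apply: integral_overM => //; exact: integral_over_base.
Qed.

Lemma span2_ring x y u v : Ai x -> Ai y ->
  span2 f x y u -> span2 f x y v -> span2 f x y (u * v).
Proof.
move=> hx hy; apply: (@invertible_integral_ring _ _ f); first exact: span2_submodule.
- by rewrite -(rmorph1 f); exact: span2_base.
- by move=> q; exact: span2_integral.
- exact: span2_invertible.
Qed.

Lemma product_span x y : Ai x -> Ai y -> exists a b c, x * y = f a + f b * x + f c * y.
Proof. by move=> hx hy; exact: (span2_ring hx hy (span2_l f x y) (span2_r f x y)). Qed.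

Lemma square_span x : Ai x -> exists a b, x * x = f a * x + f b.
Proof.
by move=> hx; have [a [b [c ->]]] := product_span hx hx; exists (b + c), a; rewrite rmorphD; ring.
Qed.

(** The integral closure is a predicate on [Q], not a type; its units are stricter than the units of
    [Q]. *)
Definition closure_unit x := exists w, Ai w /\ x * w = 1.

Lemma closure_inv_span x y : Ai y -> x * y = 1 -> exists a b, y = f a + f b * x.
Proof.
move=> hy xy; have [a [b e]] := square_span hy; exists a, b.
transitivity (x * (y * y)); first by rewrite mulrA xy mul1r.
by rewrite e mulrDr mulrCA xy mulr1 [x * _]mulrC.
Qed.

(** With [z * z = f c * z + f d], the conjugate of [1 - f a * z] is [1 - f a * f c + f a * z]; their
    product is the norm [n], a unit of [A]. It follows that [MA] lies in the Jacobson radical of the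
    closure, and so is proper. *)
Lemma closure_unit1B a z : a \isn't a GRing.unit -> Ai z -> closure_unit (1 - f a * z).
Proof.
move=> ha hz; have [c [d e]] := square_span hz.
pose n := 1 - a * (c + a * d).
have un : n \is a GRing.unit by apply: unit1B => //; exact: nonunitM.
exists ((1 - f a * f c + f a * z) * f n^-1); split.
  apply: integral_overM; last exact: integral_over_base.
  apply: integral_overD; last by apply: integral_overM => //; exact: integral_over_base.
  by rewrite -rmorphM -(rmorph1 f) -rmorphB; exact: integral_over_base.
rewrite mulrA (_ : _ * (_ + _) = f n); first by rewrite -rmorphM divrr // rmorph1.
transitivity (1 - f a * f c + f a * f a * (f c * z - z * z)); first by ring.
by rewrite e /n !(rmorphD, rmorphB, rmorphM, rmorph1); ring.
Qed.

Lemma closure_unitM x y : closure_unit x -> closure_unit y -> closure_unit (x * y).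
Proof.
move=> [u [hu xu]] [v [hv yv]]; exists (u * v); split; first exact: integral_overM.
by rewrite mulrACA xu yv mulr1.
Qed.

Lemma closure_max_unit1B y : MA y -> closure_unit (1 - y).
Proof.
elim=> [|a z x ha hz _ [w [hw e]]].
  by exists 1; split; [exact: integral_over1 | rewrite subr0 mulr1].
rewrite (_ : _ - _ = (1 - x) * (1 - f a * (z * w))).
  apply: closure_unitM; first by exists w.
  by apply: closure_unit1B => //; exact: integral_overM.
transitivity (1 - x - f a * z * ((1 - x) * w)); last by ring.
by rewrite e; ring.
Qed.

Lemma closure_max1 : ~ MA 1.
Proof. by move=> /closure_max_unit1B [w [_ /eqP]]; rewrite subrr mul0r eq_sym oner_eq0. Qed.

Lemma closure_max_nonunit a : MA (f a) -> a \isn't a GRing.unit.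
Proof.
move=> h; apply/negP => ua; apply: closure_max1.
rewrite -(rmorph1 f) -(mulVr ua) rmorphM; apply: closure_maxM => //.
exact: integral_over_base.
Qed.

Definition max_endo e := forall a, a \isn't a GRing.unit ->
  exists b, b \isn't a GRing.unit /\ e * f a = f b.

(* With [N = A + Ae], either the stabilizer of [N] is [N], or it is [A]; in the latter case
   [N] is principal over [A], which forces [e] into [A] because [eM] lies in [M]. *)
Lemma max_endo_integral e : max_endo e -> Ai e.
Proof.
move=> he; pose N := span2 f e 0.
have NP q : N q -> exists a b, q = f a + f b * e.
  by move=> [a [b [c ->]]]; exists a, b; rewrite mulr0 addr0.
have Ne : N e by exact: span2_l.
have N1 : N 1 by rewrite -(rmorph1 f); exact: span2_base.
have hN : submodule f N by exact: span2_submodule.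
case: (pselect (exists a b, b \is a GRing.unit /\ stabilizer N (f a + f b * e))).
  move=> [a [b [ub hab]]].
  have he' : stabilizer N e.
    rewrite (_ : e = f b^-1 * ((f a + f b * e) + f (- a))).
      apply: stabilizerM; first exact: stabilizer_base.
      by apply: (stabilizerD hN) => //; exact: stabilizer_base.
    by rewrite rmorphN addrC addrA addNr add0r mulrA -rmorphM mulVr // rmorph1 mul1r.
  by apply: integral_over_quadratic_span; exact: NP (he' e Ne).
move=> no.
have stab_base q : stabilizer N q -> exists a, q = f a.
  move=> hq; have [a [b e1]] : exists a b, q = f a + f b * e by apply: NP; rewrite -[q]mulr1; exact: hq.
  have nb : b \isn't a GRing.unit by apply/negP => ub; apply: no; exists a, b; rewrite -e1.
  have [c [_ hc]] := he b nb.
  by exists (a + c); rewrite rmorphD -hc e1 mulrC.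
pose S q := exists a, a \isn't a GRing.unit /\ q = f a.
have [q [g [Ng hq nS]]] : exists q g, [/\ N g, forall w, N w -> stabilizer N (q * w) & ~ S (q * g)].
  apply: invertible_pick (span2_invertible e 0).
  - by exists 0; rewrite unitr0 rmorph0.
  - by move=> _ _ [a [na ->]] [b [nb ->]]; exists (a + b); rewrite rmorphD; split=> //; exact: nonunitD.
  - by move=> [a [/negP na]]; rewrite -(rmorph1 f) => /finj a1; apply: na; rewrite -a1 unitr1.
have [u hu] := stab_base _ (hq g Ng).
have uu : u \is a GRing.unit by apply: contraT => nu; case: nS; exists u.
have gen w : N w -> exists c, w = g * f c.
  move=> Nw; have [c hc] := stab_base _ (hq w Nw); exists (c / u).
  rewrite rmorphM mulrA -hc (_ : g * (q * w) = f u * w); last by rewrite -hu; ring.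
  by rewrite mulrAC -rmorphM divrr // rmorph1 mul1r.
have [a ha] := gen 1 N1; have [b hb] := gen e Ne.
have [p [r hg]] := NP g Ng.
case: (boolP (a \is a GRing.unit)) => [ua|na].
  rewrite hb (_ : g * f b = f (b / a)); first exact: integral_over_base.
  have -> : g = f a^-1 by rewrite -[LHS]mulr1 -(rmorph1 f) -(divrr ua) rmorphM mulrA -ha mul1r.
  by rewrite -rmorphM mulrC.
have [c [nc hc]] := he a na.
have : f 1 = f (p * a + r * c).
  by rewrite rmorph1 ha hg rmorphD !rmorphM -hc; ring.
move=> /finj e1.
have : p * a + r * c \isn't a GRing.unit by apply: nonunitD => //; rewrite mulrC; exact: nonunitM.
by rewrite -e1 unitr1.
Qed.

(* [Y^2 - aY - b] is the minimal equation of [x]; [(x - t)(z - u)] lies in [A] for some [t, u],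
   and [x - t] has norm [t^2 - at - b]. *)
Lemma norm_relation x a b z : Ai x -> x * x = f a * x + f b -> Ai z ->
  exists t u c, (x - f t) * (z - f u) = f c /\
    f (t * t - a * t - b) * (z - f u) = f c * (f (a - t) - x).
Proof.
move=> hx ex hz; have [t1 [t2 [t3 e]]] := product_span hx hz.
exists t3, t2, (t1 + t2 * t3); have e1 : (x - f t3) * (z - f t2) = f (t1 + t2 * t3).
  transitivity (x * z - x * f t2 - f t3 * z + f t3 * f t2); first by ring.
  by rewrite e rmorphD rmorphM; ring.
split=> //; rewrite -e1.
have -> : f (t3 * t3 - a * t3 - b) = (x - f t3) * (f (a - t3) - x).
  transitivity (f t3 * f t3 - f a * f t3 - x * x + f a * x); last by rewrite rmorphB; ring.
  by rewrite ex !(rmorphB, rmorphM); ring.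
by ring.
Qed.

Lemma finite_of_span x : Ai x -> (forall y, Ai y -> exists p q, y = f p + f q * x) ->
  finite_closure_in f.
Proof.
move=> hx hspan; exists [:: 1; x]; split.
  by move=> g; rewrite !inE => /orP[/eqP->|/eqP->] //; exact: integral_over1.
move=> y hy; have [p [q ->]] := hspan y hy.
exists [:: p; q]; split => //=.
by rewrite !big_ord_recl big_ord0 /= mulr1 addr0.
Qed.

(** The equation of [x] has no root in the residue field, so the norm of every [x - f t] is a unit
    and [norm_relation] can be divided by it. *)
Lemma finite_of_rootless x a b : Ai x -> x * x = f a * x + f b ->
  (forall t, t * t - a * t - b \is a GRing.unit) -> finite_closure_in f.
Proof.
move=> hx ex hr; apply: (finite_of_span hx) => z hz.
have [t [u [c [_ e]]]] := norm_relation hx ex hz.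
have un := hr t; set n := t * t - a * t - b in un e.
exists (u + c / n * (a - t)), (- (c / n)).
have -> : z = f u + f n^-1 * (f n * (z - f u)).
  by rewrite mulrA -rmorphM mulVr // rmorph1; ring.
by rewrite e !(rmorphD, rmorphM, rmorphN, rmorphB) /=; ring.
Qed.

Definition in_span x y := exists p q, y = f p + f q * x.

Lemma in_spanD x y z : in_span x y -> in_span x z -> in_span x (y + z).
Proof.
move=> [p [q ->]] [r [s ->]]; exists (p + r), (q + s); rewrite !rmorphD; ring.
Qed.

Lemma in_spanZ x a y : in_span x y -> in_span x (f a * y).
Proof. by move=> [p [q ->]]; exists (a * p), (a * q); rewrite !rmorphM; ring. Qed.

Lemma in_span_div x a y : a \is a GRing.unit -> in_span x (f a * y) -> in_span x y.
Proof.
by move=> ua /(in_spanZ a^-1); rewrite mulrA -rmorphM mulVr // rmorph1 mul1r.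
Qed.

Definition near_base x := exists a y, MA y /\ x = f a + y.

(** * Elements of the closure that are idempotent modulo the maximal ideal of the base *)

Section Idempotent.
Variables (e y : Q) (b t1 t2 t3 : A).
Hypotheses (he : Ai e) (hb : b \isn't a GRing.unit) (ee : e * e = e + f b).
Hypotheses (ne : ~ near_base e) (hy : Ai y) (ny : ~ in_span e y).
Hypotheses (ey : e * y = f t1 + f t2 * e + f t3 * y) (ht3 : t3 \isn't a GRing.unit).

(** Multiplying the relation for [e * y] once more by [e] gives [e * y = (t1 + t2) e] modulo nonunit
    multiples; the translate [y'] is thus orthogonal to [e] in the residue algebra. *)
Let y' := y - f (t1 + t2).
Let hy' : Ai y'. Proof. by apply: integral_overB => //; exact: integral_over_base. Qed.
Let D := span2 f e y'.
Let MD q := exists p r s, [/\ p \isn't a GRing.unit, r \isn't a GRing.unit,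
  s \isn't a GRing.unit & q = f p + f r * e + f s * y'].

(** [1], [e], [y'] form a basis of [D / MD]. A unit coefficient at [y'] would put [y] into [A + Ae],
    one at [e] would make [e] near the base, and one at [1] would be a unit of [A] inside [MA]. *)
Let indep p r s : MD (f p + f r * e + f s * y') ->
  [/\ p \isn't a GRing.unit, r \isn't a GRing.unit & s \isn't a GRing.unit].
Proof.
move=> [p' [r' [s' [np nr ns e0]]]].
have e1 : f (s - s') * y' = f (p' - p) + f (r' - r) * e.
  rewrite !rmorphB; apply/eqP; rewrite -subr_eq0; apply/eqP.
  transitivity (f p + f r * e + f s * y' - (f p' + f r' * e + f s' * y')); first by ring.
  by rewrite e0 subrr.
have n1 : s - s' \isn't a GRing.unit.
  apply/negP => u; apply: ny; rewrite (_ : y = y' + f (t1 + t2)); last by rewrite /y' subrK.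
  apply: in_spanD; last by exists (t1 + t2), 0; rewrite rmorph0; ring.
  by apply: (in_span_div u); rewrite e1; exists (p' - p), (r' - r).
have ns0 : s \isn't a GRing.unit by rewrite -(subrK s' s); exact: nonunitD.
have e2 : f (r - r') * e = f (p' - p) + f (s' - s) * y'.
  transitivity (f (p' - p) - (f (p' - p) + f (r' - r) * e)); last by rewrite -e1 !rmorphB; ring.
  by rewrite !rmorphB; ring.
have m1 : MA (f (s' - s) * y').
  by apply: closure_maxMl => //; apply: closure_max_base; rewrite -opprB; exact: nonunitN.
have n2 : r - r' \isn't a GRing.unit.
  apply/negP => u; apply: ne; exists ((r - r')^-1 * (p' - p)), (f (r - r')^-1 * (f (s' - s) * y')).
  split; first by apply: closure_maxM => //; exact: integral_over_base.
  by rewrite rmorphM -mulrDr -e2 mulrA -rmorphM mulVr // rmorph1 mul1r.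
have nr0 : r \isn't a GRing.unit by rewrite -(subrK r' r); exact: nonunitD.
split=> //; rewrite -(subrK p' p); apply: nonunitD => //.
apply: closure_max_nonunit; rewrite (_ : f (p - p') = f (s' - s) * y' - f (r - r') * e).
  apply: closure_maxB => //; apply: closure_maxMl => //; exact: closure_max_base.
by rewrite e2 !rmorphB; ring.
Qed.

Let MD_D q : MD q -> D q.
Proof. by move=> [p [r [s [_ _ _ ->]]]]; exists p, r, s. Qed.

Let MDD p q : MD p -> MD q -> MD (p + q).
Proof.
move=> [p1 [p2 [p3 [h1 h2 h3 ->]]]] [q1 [q2 [q3 [k1 k2 k3 ->]]]].
exists (p1 + q1), (p2 + q2), (p3 + q3); split; try exact: nonunitD.
by rewrite !rmorphD; ring.
Qed.

Let MD_base a d : a \isn't a GRing.unit -> D d -> MD (f a * d).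
Proof.
move=> na [p [r [s ->]]]; exists (a * p), (a * r), (a * s).
by split; try exact: nonunitM; rewrite !rmorphM; ring.
Qed.

Let De : D e. Proof. exact: span2_l. Qed.
Let Dy : D y'. Proof. exact: span2_r. Qed.
Let Df a : D (f a). Proof. exact: span2_base. Qed.
Let D1 : D 1. Proof. by rewrite -(rmorph1 f). Qed.
Let DM p q : D p -> D q -> D (p * q). Proof. exact: span2_ring. Qed.
Let DD p q : D p -> D q -> D (p + q).
Proof. by have [_ h _] := span2_submodule f e y'; exact: h. Qed.

Let MDM q d : MD q -> D d -> MD (q * d).
Proof.
move=> [p [r [s [np nr ns ->]]]] Dd.
rewrite (_ : _ * d = f p * d + f r * (e * d) + f s * (y' * d)); last by ring.
by apply: (MDD); [apply: (MDD)|]; apply: MD_base => //; exact: DM.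
Qed.

Let MDN q : MD q -> MD (- q).
Proof. by move=> h; rewrite -mulrN1; apply: MDM => //; rewrite -(rmorph1 f) -rmorphN. Qed.

Let MD0 : MD 0.
Proof. by exists 0, 0, 0; rewrite unitr0 !rmorph0; split => //; ring. Qed.

Let MDf a : a \isn't a GRing.unit -> MD (f a).
Proof. by move=> na; rewrite -[f a]mulr1; exact: MD_base. Qed.

Let ey' : MD (e * y').
Proof.
rewrite (_ : e * y' = f (- (t1 * b)) + f t3 * (e * y) + f (- b) * y').
  apply: (MDD); [apply: (MDD)|].
  - by apply: MDf; apply: nonunitN; rewrite mulrC; exact: nonunitM.
  - apply: MD_base => //; rewrite (_ : y = y' + f (t1 + t2)); last by rewrite /y' subrK.
    by apply: DM => //; exact: DD.
  - by apply: MD_base => //; exact: nonunitN.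
have e1 : e * (e * y) = e * y + f b * y by rewrite mulrA ee mulrDl.
have e2 : e * (e * y) = f t1 * e + f t2 * (e + f b) + f t3 * (e * y).
  by rewrite {1}ey -ee; ring.
have e3 : f t3 * (e * y) = e * y + f b * y - (f t1 * e + f t2 * (e + f b)).
  by rewrite -e1 e2; ring.
by rewrite e3 /y' !(rmorphN, rmorphM, rmorphD); ring.
Qed.

(** In the quadratic relation of [y'], multiplication by [e] shows that the constant term is a
    nonunit. The relation of [e + y'] forces the linear coefficients of [e] and [y'] to agree modulo
    nonunits, and that of [e] is [1]. *)
Let yy' : MD (y' * y' - y').
Proof.
have [s2 [s1 es]] := square_span hy'.
have n1 : s1 \isn't a GRing.unit.
  have : MD (f 0 + f s1 * e + f 0 * y').
    rewrite rmorph0 mul0r addr0 add0r (_ : _ * e = (e * y') * y' - f s2 * (e * y')).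
      by apply: (MDD); [exact: MDM | apply: MDN; rewrite mulrC; exact: MDM].
    by rewrite -mulrA es; ring.
  by case/indep.
have [p [q ew]] := square_span (integral_overD he hy').
have : MD (f (s1 - q + b) + f (1 - p) * e + f (s2 - p) * y').
  rewrite (_ : _ + _ = - (2 * (e * y'))).
    by apply: MDN; rewrite mulrC; apply: MDM => //; rewrite -(rmorph_nat f).
  have e1 : e + f b + 2 * (e * y') + (f s2 * y' + f s1) = f p * (e + y') + f q.
    by rewrite -ew -es -ee; ring.
  apply/eqP; rewrite -subr_eq0; apply/eqP.
  transitivity (e + f b + 2 * (e * y') + (f s2 * y' + f s1) - (f p * (e + y') + f q)).
    by rewrite !(rmorphB, rmorphD, rmorph1); ring.
  by rewrite e1 subrr.
case/indep => _ n2 n3.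
rewrite es (_ : _ - _ = f s1 + f (s2 - 1) * y'); last by rewrite rmorphB rmorph1; ring.
apply: (MDD); first exact: MDf.
apply: MD_base => //; rewrite (_ : s2 - 1 = (s2 - p) - (1 - p)); last by ring.
by apply: nonunitD => //; exact: nonunitN.
Qed.

(* In [D/MD = k x k x k], spanned by the idempotents [e], [y'] and [1 - e - y'], this is a
   plane whose stabilizer is [k]; over the local ring [k + MD] it needs two generators. *)
Let W q := exists u v n, MD n /\ q = f u * (1 - e) + f v * (1 - y') + n.

Let W1 : W (1 - e). Proof. by exists 1, 0, 0; rewrite rmorph0 rmorph1; split => //; ring. Qed.
Let W2 : W (1 - y'). Proof. by exists 0, 1, 0; rewrite rmorph0 rmorph1; split => //; ring. Qed.
Let WMD q : MD q -> W q. Proof. by move=> h; exists 0, 0, q; rewrite rmorph0; split => //; ring. Qed.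

Let DB p q : D p -> D q -> D (p - q).
Proof. by move=> hp hq; apply: DD => //; rewrite -mulN1r; apply: DM => //; rewrite -(rmorph1 f) -rmorphN. Qed.

Let W_D q : W q -> D q.
Proof.
move=> [u [v [n [hn ->]]]].
apply: DD; last exact: MD_D.
by apply: DD; apply: DM => //; exact: DB.
Qed.

Let W_invertible : invertible_module W.
Proof.
apply: stable_invertible.
- split; first by apply: WMD.
    move=> _ _ [u [v [n [hn ->]]]] [u' [v' [n' [hn' ->]]]].
    by exists (u + u'), (v + v'), (n + n'); split; [exact: MDD | rewrite !rmorphD; ring].
  move=> a _ [u [v [n [hn ->]]]]; exists (a * u), (a * v), (f a * n); split.
    by rewrite mulrC; exact: MDM.
  by rewrite !rmorphM; ring.
- have [k hk] := fractional_span2 e y'; exists k => x /W_D; exact: hk.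
- by exists (f m); split => //; apply: WMD; exact: MDf.
Qed.

Let W_coords u v n p q r s : MD n -> MD s ->
  f u * (1 - e) + f v * (1 - y') + n = f p + f q * e + f r * y' + s ->
  [/\ p - (u + v) \isn't a GRing.unit, q + u \isn't a GRing.unit & r + v \isn't a GRing.unit].
Proof.
move=> hn hs e0; apply: indep.
rewrite (_ : _ + _ = n - s); first by apply: (MDD) => //; exact: MDN.
apply/eqP; rewrite -subr_eq0; apply/eqP.
transitivity (f p + f q * e + f r * y' + s - (f u * (1 - e) + f v * (1 - y') + n)).
  by rewrite !(rmorphB, rmorphD); ring.
by rewrite e0 subrr.
Qed.

(** [W] consists of the elements of [D] whose coordinates on [1], [e], [y'] sum to zero in the
    residue field. For [c] with coordinates [p], [q], [r], the product with [1 - e] has coordinate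
    sum [r], and the product with [1 - y'] has sum [q]; both must vanish. *)
Let W_stab c : stabilizer W c -> exists p n, MD n /\ c = f p + n.
Proof.
move=> hc; have c1 := hc _ W1; have c2 := hc _ W2.
have [p [q [r ec]]] : D c.
  rewrite (_ : c = c * (1 - e) + e * (c * (1 - y')) + c * (e * y')); last by ring.
  apply: DD; last by apply: W_D; apply: hc; exact: WMD.
  by apply: DD; [exact: W_D | apply: DM => //; exact: W_D].
have [u [v [n [hn e1]]]] := c1.
have [] := @W_coords u v n p (- p) r (- (f q * f b) - f r * (e * y')) hn _ _.
- apply: (MDD); apply: MDN; first by rewrite -rmorphM; apply: MDf; rewrite mulrC; exact: nonunitM.
  by rewrite mulrC; exact: MDM.
- rewrite -e1 ec rmorphN; transitivity (f p * (1 - e) + f q * (e - e * e) + f r * (y' - e * y')); first by ring.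
  by rewrite ee; ring.
move=> n1 n2 n3.
have nr : r \isn't a GRing.unit.
  rewrite (_ : r = (r + v) + ((p - (u + v)) + (- p + u))); last by ring.
  by apply: nonunitD => //; exact: nonunitD.
have [u' [v' [n' [hn' e2]]]] := c2.
have [] := @W_coords u' v' n' p q (- p) (- (f q * (e * y')) - f r * (y' * y' - y')) hn' _ _.
- by apply: (MDD); apply: MDN; rewrite mulrC; exact: MDM.
- by rewrite -e2 ec rmorphN; ring.
move=> k1 k2 k3.
have nq : q \isn't a GRing.unit.
  rewrite (_ : q = (q + u') + ((p - (u' + v')) + (- p + v'))); last by ring.
  by apply: nonunitD => //; exact: nonunitD.
exists p, (f q * e + f r * y'); split; last by rewrite ec addrA.
by apply: (MDD); exact: MD_base.
Qed.

(** [invertible_pick] with [S = MD] yields a product [q * g] that is a unit of [A] up to [MD], so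
    [g] generates [W] modulo [MD]; yet [1 - e] and [1 - y'] are not proportional there. *)
Lemma idempotent_contra : False.
Proof.
have [|g [x]] := invertible_pick MD0 MDD _ W_invertible.
  rewrite -(rmorph1 f) (_ : f 1 = f 1 + f 0 * e + f 0 * y'); last by rewrite rmorph0; ring.
  by case/indep; rewrite unitr1.
move: x g => g q [Wg hq nS].
have [p [n [hn hp]]] := W_stab (hq g Wg).
have up : p \is a GRing.unit.
  by apply: contraT => np; case: nS; rewrite hp; apply: (MDD) => //; exact: MDf.
have [u [v [n0 [hn0 eg]]]] := Wg.
have Dg := W_D Wg.
have gen w : W w -> exists c s, MD s /\ w = f c * g + s.
  move=> Ww; have [c [s [hs ec]]] := W_stab (hq w Ww); have Dw := W_D Ww.
  exists (p^-1 * c), (f p^-1 * (g * s - n * w)); split.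
    rewrite mulrC; apply: MDM => //; apply: (MDD); first by rewrite mulrC; exact: MDM.
    by apply: MDN; exact: MDM.
  have e1 : f p * w = f c * g + (g * s - n * w).
    transitivity ((q * g) * w - n * w); first by rewrite hp; ring.
    by transitivity (g * (q * w) - n * w); [ring | rewrite ec; ring].
  by rewrite rmorphM -mulrA -mulrDr -e1 mulrA -rmorphM mulVr // rmorph1 mul1r.
have [c1 [s1 [hs1 e1]]] := gen _ W1.
have [c2 [s2 [hs2 e2]]] := gen _ W2.
have [] := @W_coords (c1 * u) (c1 * v) (f c1 * n0 + s1) 1 (- 1) 0 0 _ MD0 _.
- by apply: (MDD) => //; rewrite mulrC; exact: MDM.
- rewrite rmorph0 rmorphN rmorph1; transitivity (1 - e); last by ring.
  by rewrite [RHS]e1 [in RHS]eg !rmorphM; ring.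
move=> _ k2 k3.
have uc : c1 * u \is a GRing.unit.
  apply: contraT => nc; suff : (- 1 : A) \isn't a GRing.unit by rewrite unitrN unitr1.
  by rewrite -(addrK (c1 * u) (-1)); apply: nonunitD => //; exact: nonunitN.
have nv : v \isn't a GRing.unit.
  move: k3; rewrite add0r => k3; apply/negP => uv.
  by move: uc k3; rewrite !unitrM uv => /andP[->].
have [] := @W_coords (c2 * u) (c2 * v) (f c2 * n0 + s2) 1 0 (- 1) 0 _ MD0 _.
- by apply: (MDD) => //; rewrite mulrC; exact: MDM.
- rewrite rmorph0 rmorphN rmorph1; transitivity (1 - y'); last by ring.
  by rewrite [RHS]e2 [in RHS]eg !rmorphM; ring.
move=> _ _ k4.
suff : (- 1 : A) \isn't a GRing.unit by rewrite unitrN unitr1.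
rewrite -(addrK (c2 * v) (-1)); apply: nonunitD => //; apply: nonunitN.
by rewrite mulrC; exact: nonunitM.
Qed.

End Idempotent.

Lemma span_of_idempotent e b : Ai e -> b \isn't a GRing.unit -> e * e = e + f b ->
  ~ near_base e -> forall y, Ai y -> in_span e y.
Proof.
move=> he nb ee ne y hy; apply: contrapT => ny.
have [t1 [t2 [t3 ey]]] := product_span he hy.
(* Computing [e * (e * y)] in two ways puts [((1 - t3) * t3 + b) * y] into [A + Ae], so this
   coefficient is a nonunit. Hence [t3] is [0] or [1] in the residue field, and passing from [e] to
   [1 - e] exchanges the two cases. *)
have nk : (1 - t3) * t3 + b \isn't a GRing.unit.
  apply/negP => u; apply: ny; apply: (in_span_div u).
  exists (t2 * b - (1 - t3) * t1), (t1 + t2 - (1 - t3) * t2).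
  have e1 : e * (e * y) = e * y + f b * y by rewrite mulrA ee mulrDl.
  have e2 : e * (e * y) = f t1 * e + f t2 * (e + f b) + f t3 * (e * y).
    by rewrite {1}ey -ee; ring.
  have e3 : f t3 * y = e * y - f t1 - f t2 * e by rewrite ey; ring.
  have e4 : f b * y = f t1 * e + f t2 * (e + f b) + f t3 * (e * y) - e * y.
    by rewrite -e2 e1; ring.
  transitivity ((1 - f t3) * (f t3 * y) + f b * y).
    by rewrite !(rmorphD, rmorphM, rmorphB, rmorph1); ring.
  by rewrite e3 e4 !(rmorphD, rmorphM, rmorphB, rmorph1); ring.
have : (1 - t3) * t3 \isn't a GRing.unit.
  by rewrite -[_ * _](addrK b); apply: nonunitD => //; exact: nonunitN.
rewrite unitrM negb_and => /orP[n1|n3]; last exact: idempotent_contra ee ne hy ny ey n3.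
apply: (@idempotent_contra (1 - e) y b (- (t1 + t2)) t2 (1 - t3)) => //.
- by apply: integral_overB => //; exact: integral_over1.
- by transitivity (1 - 2 * e + e * e); [ring | rewrite ee; ring].
- move=> [a [z [hz ez]]]; apply: ne; exists (1 - a), (- z); split; first exact: closure_maxN.
  by rewrite rmorphB rmorph1; transitivity (1 - (1 - e)); [ring | rewrite ez; ring].
- move=> [p [q eq]]; apply: ny; exists (p + q), (- q).
  by rewrite eq rmorphD rmorphN; ring.
- by rewrite mulrBl ey !(rmorphN, rmorphD, rmorphB, rmorph1); ring.
Qed.

(** * The maximal ideal of a non-finite integral closure *)

Section NotFinite.
Hypothesis hnf : ~ finite_closure_in f.

(** Unless [y] is near the base, its equation modulo nonunits has a root [t], by
    [finite_of_rootless]. The difference of the two roots is [c = a - 2 * t]: if it is a unit,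
    [x / c] is idempotent up to the nonunit [n / c / c] and the closure is finite; otherwise the
    root is double and the square of [y - f t] lies in [MA]. *)
Lemma square_near_base y : Ai y -> exists t, MA ((y - f t) * (y - f t)).
Proof.
move=> hy; case: (pselect (near_base y)) => [[t [z [hz ->]]]|ny].
  exists t; rewrite (_ : f t + z - f t = z); last by ring.
  by apply: closure_maxM => //; exact: closure_max_integral.
have [a [b ey]] := square_span hy.
have [t nt] : exists t, t * t - a * t - b \isn't a GRing.unit.
  by apply: contrapT => no; apply: hnf; apply: (finite_of_rootless hy ey) => t;
    apply: contraT => nt; case: no; exists t.
exists t; pose x := y - f t; rewrite -/x.
set n := t * t - a * t - b in nt.
have ex : x * x = f (a - 2 * t) * x - f n.
  transitivity (y * y - 2 * f t * y + f t * f t); first by rewrite /x; ring.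
  by rewrite ey /x /n !(rmorphB, rmorphM, rmorphD, rmorph_nat); ring.
have hx : Ai x by apply: integral_overB => //; exact: integral_over_base.
case: (boolP (a - 2 * t \is a GRing.unit)) => [u|nu]; last first.
  rewrite ex; apply: closure_maxB; last exact: closure_max_base.
  by apply: closure_maxMl => //; exact: closure_max_base.
set c := a - 2 * t in u ex.
case: hnf; apply: (finite_of_span hy) => z hz.
have [] := @span_of_idempotent (f c^-1 * x) (- (n / c / c)) _ _ _ _ z hz.
- by apply: integral_overM => //; exact: integral_over_base.
- by apply: nonunitN; apply: nonunitM; exact: nonunitM.
- transitivity (f c^-1 * f c^-1 * (x * x)); first by ring.
  have ecc : f c^-1 * f c = 1 by rewrite -rmorphM mulVr // rmorph1.
  rewrite ex rmorphN !rmorphM.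
  by transitivity ((f c^-1 * f c) * (f c^-1 * x) - f n * f c^-1 * f c^-1); [ring | rewrite ecc; ring].
- move=> [a' [w [hw ew]]]; apply: ny; exists (c * a' + t), (f c * w).
  split; first by apply: closure_maxM => //; exact: integral_over_base.
  rewrite rmorphD rmorphM addrAC -mulrDr -ew mulrA -rmorphM divrr // rmorph1 mul1r.
  by rewrite /x subrK.
move=> p [q ->]; exists (p - q / c * t), (q / c).
by rewrite /x rmorphB !rmorphM; ring.
Qed.

(* The maximal ideal of the integral closure. *)
Definition closure_nil y := Ai y /\ MA (y * y).

Lemma closure_max_nil y : MA y -> closure_nil y.
Proof.
move=> hy; have iy := closure_max_integral hy.
by split=> //; exact: closure_maxM.
Qed.

Lemma closure_nil_unit y : closure_nil y -> ~ closure_unit y.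
Proof.
move=> [_ hy] [w [hw e]]; apply: closure_max1.
rewrite (_ : 1 = (w * w) * (y * y)); last by transitivity ((y * w) * (y * w)); [rewrite e mulr1 | ring].
by apply: closure_maxM => //; exact: integral_overM.
Qed.

Lemma closure_nil1 : ~ closure_nil 1.
Proof.
move/closure_nil_unit; apply; exists 1.
by split; [exact: integral_over1 | rewrite mulr1].
Qed.

Lemma closure_nilM x y : Ai x -> closure_nil y -> closure_nil (x * y).
Proof.
move=> hx [hy hyy]; split; first exact: integral_overM.
by rewrite mulrACA; apply: closure_maxM => //; exact: integral_overM.
Qed.

Lemma closure_decomp y : Ai y -> exists t n, closure_nil n /\ y = f t + n.
Proof.
move=> hy; have [t ht] := square_near_base hy; exists t, (y - f t).
by split; [split=> //; apply: integral_overB => //; exact: integral_over_base | ring].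
Qed.

Lemma closure_nil_or_unit y : Ai y -> closure_nil y \/ closure_unit y.
Proof.
move=> hy; have [t [n [[hn hnn] e]]] := closure_decomp hy.
case: (boolP (t \is a GRing.unit)) => [ut|nt].
  (* [(f t + n) * (f t - n)] is [f t ^+ 2] times [1 - (n / f t) ^+ 2], and the latter is invertible
     because [n * n] lies in [MA]. *)
  right; have mn : MA (f t^-1 * f t^-1 * (n * n)).
    by apply: closure_maxM => //; apply: integral_overM; exact: integral_over_base.
  have [w [hw ew]] := closure_max_unit1B mn.
  exists (f t^-1 * f t^-1 * (f t - n) * w).
  split; last first.
    have et : f t * f t^-1 = 1 by rewrite -rmorphM divrr // rmorph1.
    rewrite -ew e; transitivity (((f t * f t^-1) * (f t * f t^-1) - f t^-1 * f t^-1 * (n * n)) * w).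
      by ring.
    by rewrite et mulr1.
  apply: integral_overM => //; apply: integral_overM.
    by apply: integral_overM; exact: integral_over_base.
  by apply: integral_overB => //; exact: integral_over_base.
left; split=> //; rewrite e (_ : _ * _ = f t * (f t + 2 * n) + n * n); last by ring.
apply: closure_maxD => //; apply: closure_maxMl; last exact: closure_max_base.
apply: integral_overD; first exact: integral_over_base.
by apply: integral_overM => //; rewrite -(rmorph_nat f); exact: integral_over_base.
Qed.

Lemma closure_nil_of_not_unit y : Ai y -> ~ closure_unit y -> closure_nil y.
Proof. by move=> /closure_nil_or_unit[]. Qed.

Lemma closure_nilD x y : closure_nil x -> closure_nil y -> closure_nil (x + y).
Proof.
move=> nx ny; have hx := nx.1; have hy := ny.1.
apply: closure_nil_of_not_unit; first exact: integral_overD.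
move=> [w [hw e]]; have [[hxw hxx] [hyw hyy]] := (closure_nilM hw nx, closure_nilM hw ny).
apply: closure_max1.
set p := w * x in hxw hxx; set q := w * y in hyw hyy.
have epq : p + q = 1 by rewrite -e /p /q; ring.
(* The cube of [p + q = 1]: each of its monomials contains [p * p] or [q * q]. *)
rewrite (_ : 1 = (p + 3 * q) * (p * p) + (3 * p + q) * (q * q)).
  have h3 : Ai 3 by rewrite -(rmorph_nat f); exact: integral_over_base.
  by apply: closure_maxD; apply: closure_maxM => //; apply: integral_overD => //; exact: integral_overM.
by transitivity ((p + q) ^+ 3); [rewrite epq expr1n | ring].
Qed.

Lemma closure_nil0 : closure_nil 0.
Proof. by apply: closure_max_nil; exact: closure_max0. Qed.

Lemma closure_unit1B_nil x : closure_nil x -> closure_unit (1 - x).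
Proof.
move=> nx; have [n1|//] := @closure_nil_or_unit (1 - x) (integral_overB (integral_over1 f) nx.1).
by case: closure_nil1; rewrite -(subrK x 1); exact: closure_nilD.
Qed.

(* [Ax + Ay] is invertible over its stabilizer, which is integral by Cayley-Hamilton. *)
Lemma closure_valuation x y : x \is a GRing.unit ->
  (exists z, Ai z /\ y = x * z) \/ (exists z, Ai z /\ x = y * z).
Proof.
move=> ux; pose W q := exists a b, q = f a * x + f b * y.
have Wx : W x by exists 1, 0; rewrite rmorph0 rmorph1; ring.
have Wy : W y by exists 0, 1; rewrite rmorph0 rmorph1; ring.
have inv : invertible_module W.
  apply: stable_invertible.
  - split; first by exists 0, 0; rewrite rmorph0; ring.
      by move=> _ _ [a [b ->]] [c [d ->]]; exists (a + c), (b + d); rewrite !rmorphD; ring.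
    by move=> r _ [a [b ->]]; exists (r * a), (r * b); rewrite !rmorphM; ring.
  - have [k hk] := common_denominator dvdm [:: x; y] hQ.
    have [a ha] := hk x (mem_head _ _).
    have [b hb] : exists b, f m ^+ k * y = f b by apply: hk; rewrite !inE eqxx orbT.
    exists k => _ [c [d ->]]; exists (c * a + d * b).
    by rewrite rmorphD !rmorphM -ha -hb; ring.
  - by exists x.
have stabI q : stabilizer W q -> Ai q.
  move=> hq; have [a [b e1]] := hq x Wx; have [c [d e2]] := hq y Wy.
  (* Trace and negated determinant of multiplication by [q] on the generators [x], [y]. *)
  apply: (@integral_quadratic _ _ _ _ (a + d) (b * c - a * d)).
  apply: (mulIr ux).
  have e3 : (q - f d) * ((q - f a) * x) = f b * (f c * x).
    have -> : (q - f a) * x = f b * y by rewrite mulrBl e1; ring.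
    by transitivity (f b * (q * y) - f b * f d * y); [ring | rewrite e2; ring].
  transitivity ((q - f d) * ((q - f a) * x) + (f a + f d) * q * x - f a * f d * x); first by ring.
  by rewrite e3 !(rmorphB, rmorphD, rmorphM); ring.
have [q [g [[p [r eg]] hq nS]]] := invertible_pick closure_nil0 closure_nilD closure_nil1 inv.
have hx := stabI _ (hq x Wx); have hy := stabI _ (hq y Wy).
case: (closure_nil_or_unit hx) => [nx|[w [hw e]]]; last first.
  left; exists (q * y * w); split; first exact: integral_overM.
  by transitivity (q * x * w * y); [rewrite e mul1r | ring].
case: (closure_nil_or_unit hy) => [ny|[w [hw e]]]; last first.
  right; exists (q * x * w); split; first exact: integral_overM.
  by transitivity (q * y * w * x); [rewrite e mul1r | ring].
case: nS; rewrite eg (_ : q * _ = f p * (q * x) + f r * (q * y)); last by ring.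
by apply: closure_nilD; apply: closure_nilM => //; exact: integral_over_base.
Qed.

Definition base_max q := exists a, a \isn't a GRing.unit /\ q = f a.

Lemma base_max_submodule : submodule f base_max.
Proof.
split; first by exists 0; rewrite unitr0 rmorph0.
  move=> _ _ [a [na ->]] [b [nb ->]]; exists (a + b); rewrite rmorphD; split=> //.
  exact: nonunitD.
move=> r _ [a [na ->]]; exists (r * a); rewrite rmorphM; split=> //.
by rewrite mulrC; exact: nonunitM.
Qed.

Lemma stabilizer_max e : stabilizer base_max e -> max_endo e.
Proof. by move=> h a na; have [|b [nb eb]] := h (f a); [exists a | exists b]. Qed.

Lemma stabilizer_inv x y : submodule f base_max -> stabilizer base_max x -> Ai y -> x * y = 1 ->
  stabilizer base_max y.
Proof.
move=> hM hx hy e; have [a [b ->]] := closure_inv_span hy e.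
apply: (stabilizerD hM); first exact: (stabilizer_base _ hM).
by apply: stabilizerM => //; exact: (stabilizer_base _ hM).
Qed.

(** The maximal ideal is invertible over its endomorphism ring, which is integral by
    [max_endo_integral]. A dual basis term outside [closure_nil] is a unit of the closure, and its
    inverse stays in the endomorphism ring by [stabilizer_inv]; so [g] generates the maximal ideal
    over that ring. *)
Lemma max_generator : exists g, [/\ g \isn't a GRing.unit, f g \is a GRing.unit &
  forall a, a \isn't a GRing.unit -> exists e, stabilizer base_max e /\ f a = f g * e].
Proof.
have inv : invertible_module base_max.
  apply: stable_invertible; first exact: base_max_submodule.
    by exists 0%N => _ [a [_ ->]]; exists a; rewrite mul1r.
  by exists (f m); split=> //; exists m.
have [q [_ [[g [ng ->]] hq nS]]] := invertible_pick closure_nil0 closure_nilD closure_nil1 inv.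
have Mg : base_max (f g) by exists g.
have hu := max_endo_integral (stabilizer_max (hq _ Mg)).
have [//|[w [hw e]]] := closure_nil_or_unit hu.
have sw := stabilizer_inv base_max_submodule (hq _ Mg) hw e.
exists g; split=> //; first by apply: (@unit_of _ _ (q * w)); rewrite -e; ring.
move=> a na; exists (q * f a * w); split; first by apply: stabilizerM => //; apply: hq; exists a.
by transitivity (q * f g * w * f a); [rewrite e mul1r | ring].
Qed.

Lemma closure_max_gen g y : (forall a, a \isn't a GRing.unit ->
    exists e, stabilizer base_max e /\ f a = f g * e) ->
  MA y -> exists z, Ai z /\ y = f g * z.
Proof.
move=> hg; elim=> [|a z x na hz _ [w [hw ->]]].
  by exists 0; split; [exact: integral_over0 | rewrite mulr0].
have [e [he ->]] := hg a na; exists (e * z + w); split; last by ring.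
apply: integral_overD => //; apply: integral_overM => //.
exact: max_endo_integral (stabilizer_max he).
Qed.

(** * Excluding ramification of the integral closure over the base *)

Section Uniformizer.
Variables (x : Q) (g : A).
Hypotheses (nx : closure_nil x) (xn : ~ near_base x).
Hypotheses (ng : g \isn't a GRing.unit) (ug : f g \is a GRing.unit).
Hypothesis hg : forall a, a \isn't a GRing.unit ->
  exists e, stabilizer base_max e /\ f a = f g * e.

Let nMx : ~ MA x.
Proof. by move=> h; apply: xn; exists 0, x; rewrite rmorph0 add0r. Qed.

Let MAg z : Ai z -> MA (f g * z).
Proof. by move=> hz; apply: closure_maxMl => //; exact: closure_max_base. Qed.

Let x_dvd_g : exists z, closure_nil z /\ f g = x * z.
Proof.
case: (closure_valuation x ug) => -[z [hz e]]; first by case: nMx; rewrite e; exact: MAg.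
exists z; split=> //; apply: closure_nil_of_not_unit => // -[w [hw ew]].
by apply: nMx; rewrite -[x]mulr1 -ew mulrA -e; exact: MAg.
Qed.

Let ux : x \is a GRing.unit.
Proof. by have [z [_ e]] := x_dvd_g; move: ug; rewrite e unitrM => /andP[]. Qed.

(** One factor divides the other by [closure_valuation], so the product is a multiple of a square,
    and squares from [closure_nil] lie in [MA]. *)
Let nilM y z : y \is a GRing.unit -> closure_nil y -> closure_nil z -> MA (y * z).
Proof.
move=> uy [hy hyy] [hz hzz]; case: (closure_valuation z uy) => -[w [hw e]].
  by rewrite e mulrA; exact: closure_maxMl.
by rewrite e mulrAC; exact: closure_maxMl.
Qed.

(** If instead [x = y * z] with [z] not a unit of the closure, [x] would be a product of two
    elements of [closure_nil] and hence lie in [MA]. *)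
Let nil_x y : closure_nil y -> exists z, Ai z /\ y = x * z.
Proof.
move=> ny; case: (closure_valuation y ux) => // -[z [hz e]].
have [nz|[w [hw ew]]] := closure_nil_or_unit hz.
  by case: nMx; rewrite e; apply: nilM => //; move: ux; rewrite e unitrM => /andP[].
by exists w; split=> //; rewrite e -mulrA ew mulr1.
Qed.

Let g_sq : exists z, Ai z /\ f g = x * x * z.
Proof.
have [z [nz e]] := x_dvd_g; have [w [hw ew]] := nil_x nz.
by exists w; rewrite e ew mulrA.
Qed.

Let span_mod_g y : Ai y -> exists n z, [/\ in_span x n, Ai z & y = n + f g * z].
Proof.
move=> hy; have [t [n [nn ->]]] := closure_decomp hy.
have [k [hk ->]] := nil_x nn; have [s [n' [nn' ->]]] := closure_decomp hk.
have [z [hz ez]] := closure_max_gen hg (nilM ux nx nn').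
exists (f t + f s * x), z; split=> //; first by exists t, s.
by rewrite -ez; ring.
Qed.

Let shift_unit s : s \isn't a GRing.unit -> exists u, closure_unit u /\ x - f s = x * u.
Proof.
move=> ns; have [e [he es]] := hg ns; have [z [nz ez]] := x_dvd_g.
exists (1 - e * z); split; last by rewrite es ez; ring.
apply: closure_unit1B_nil; apply: closure_nilM => //.
exact: max_endo_integral (stabilizer_max he).
Qed.

(** By [norm_relation], [f n * (z - f u)] lies in [A + Ax], so it is enough that [n] divides [m * m]
    in [A]. If [t] is a unit, so is [n]. Otherwise [n] is a unit multiple of [x * x] in the closure,
    so [g = n * k] with [k] integral; as also [n = g * e] with [e] stabilizing the maximal ideal,
    [k] is the inverse of [e] and stabilizes it too. *)
Let span_m2 z : Ai z -> in_span x (f (m * m) * z).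
Proof.
move=> hz; have hx := nx.1; have [a [b ex]] := square_span hx.
have na : a \isn't a GRing.unit.
  apply/negP => ua; apply: xn; exists (- (a^-1 * b)), (f a^-1 * (x * x)).
  split; first by apply: closure_maxM; [exact: integral_over_base | exact: nx.2].
  have e1 : f a^-1 * f a = 1 by rewrite -rmorphM mulVr // rmorph1.
  by rewrite ex mulrDr mulrA e1 rmorphN rmorphM; ring.
have nb : b \isn't a GRing.unit.
  apply: closure_max_nonunit; rewrite (_ : f b = x * x - f a * x); last by rewrite ex; ring.
  apply: closure_maxB; first exact: nx.2.
  by apply: closure_maxMl => //; exact: closure_max_base.
have [t [u [c [e1 e2]]]] := norm_relation hx ex hz.
set n := t * t - a * t - b in e2.
case: (boolP (t \is a GRing.unit)) => [ut|nt].
  have un : n \is a GRing.unit.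
    rewrite /n -addrA; apply: unitD_nonunit => //; first by rewrite unitrM ut.
    by apply: nonunitD => //; apply: nonunitN => //; exact: nonunitM.
  apply: in_spanZ; rewrite -(subrK (f u) z); apply: in_spanD; last first.
    by exists u, 0; rewrite rmorph0; ring.
  by apply: (in_span_div un); rewrite e2; exists (c * (a - t)), (- c); rewrite rmorphM rmorphN; ring.
have [v1 [hv1 ev1]] := shift_unit nt.
have [v2 [hv2 ev2]] : exists v, closure_unit v /\ x - f (a - t) = x * v.
  by apply: shift_unit; apply: nonunitD => //; exact: nonunitN.
have en : f n = - (x * x * (v1 * v2)).
  transitivity (- ((x - f t) * (x - f (a - t)))); last by rewrite ev1 ev2; ring.
  have -> : f n = f t * f t - f a * f t - (x * x - f a * x).
    by rewrite /n !(rmorphB, rmorphM) ex; ring.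
  by rewrite rmorphB; ring.
have [w [hw ew]] := closure_unitM hv1 hv2; have [th [hth eth]] := g_sq.
pose k := - (th * w).
have hk : Ai k.
  by rewrite /k -mulN1r -(rmorph1 f) -rmorphN; apply: integral_overM; [exact: integral_over_base | exact: integral_overM].
have egn : f g = f n * k.
  rewrite en /k eth; transitivity (x * x * th * (v1 * v2 * w)); last by ring.
  by rewrite ew mulr1.
have nn : n \isn't a GRing.unit.
  by apply: nonunitD => //; last exact: nonunitN; apply: nonunitD; [|exact: nonunitM|apply: nonunitN; exact: nonunitM].
have [e [he een]] := hg nn.
have ek : e * k = 1 by apply: (mulrI ug); rewrite mulrA -een -egn mulr1.
have hM := base_max_submodule.
have sk := stabilizer_inv hM he hk ek.
have [e' [he' em]] := hg hmu.
(* This is where the second factor [m] is spent: [m = n * (k * e')] with [k * e'] only in the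
   stabilizer, and multiplying by [m] lands in [A]. *)
have [d [_ ed]] : base_max (k * e' * f m).
  by apply: (stabilizerM sk he'); exists m.
have emm : f (m * m) = f d * f n.
  rewrite rmorphM -ed {1}em egn; ring.
rewrite -(subrK (f u) z) mulrDr; apply: in_spanD; last first.
  by exists (m * m * u), 0; rewrite rmorph0 !rmorphM; ring.
rewrite emm -mulrA e2; apply: in_spanZ.
by exists (c * (a - t)), (- c); rewrite rmorphM rmorphN; ring.
Qed.

(** [span_mod_g] is iterated until the power of [g] in front of the remainder is divisible by
    [m * m]; then [span_m2] absorbs the remainder, and [1], [x] span the closure. *)
Lemma uniformizer_contra : False.
Proof.
apply: hnf; apply: (finite_of_span nx.1) => y hy.
have key j z : Ai z -> exists n w, [/\ in_span x n, Ai w & z = n + f g ^+ j * w].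
  elim: j z => [|j ih] z hz.
    exists 0, z; split=> //; last by ring.
    by exists 0, 0; rewrite rmorph0; ring.
  have [n [w [hn hw ->]]] := ih z hz; have [n' [w' [hn' hw' ->]]] := span_mod_g hw.
  exists (n + f (g ^+ j) * n'), w'; split=> //; last by rewrite rmorphXn exprSr; ring.
  by apply: in_spanD => //; exact: in_spanZ.
have [j [c e]] := nilp (nonzerodivisorM hm hm) ng.
have [n [w [hn hw ->]]] := key j y hy.
apply: in_spanD => //; rewrite -rmorphXn e rmorphM -mulrA; apply: span_m2.
by apply: integral_overM => //; exact: integral_over_base.
Qed.

End Uniformizer.

Lemma closure_near_base y : Ai y -> near_base y.
Proof.
move=> hy; apply: contrapT => ny.
have [t [x [nx e]]] := closure_decomp hy.
have [g [ng ug hg]] := max_generator.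
apply: (uniformizer_contra nx _ ng ug hg) => -[a [z [hz ez]]].
by apply: ny; exists (t + a), z; rewrite rmorphD e ez addrA.
Qed.

Lemma closure_structure : exists g, [/\ g \isn't a GRing.unit,
  forall y, Ai y -> exists a z, Ai z /\ y = f a + f g * z &
  forall a, a \isn't a GRing.unit -> exists z, Ai z /\ f a = f g * z].
Proof.
have [g [ng ug hg]] := max_generator; exists g; split=> //.
  move=> y /closure_near_base [a [z [/(closure_max_gen hg) [w [hw ->]] ->]]].
  by exists a, w.
by move=> a /closure_max_base -/(_ Q f) /(closure_max_gen hg).
Qed.

End NotFinite.

End Stable.

(** * From stability to the square-zero prime of the completion *)

(** Separatedness writes each nonzero element as a power of [p] times a unit; that [D] is a domain
    follows, since no power of [p] vanishes. *)
Lemma DVR_of_uniformizer (D : comUnitRingType) (p : D) :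
  (forall d, (exists c, d * c = 1) \/ exists c, d = p * c) ->
  (forall d, (forall n, exists c, d = p ^+ n * c) -> d = 0) ->
  (forall n, p ^+ n <> 0) -> ~ (exists c, p * c = 1) -> is_DVR D.
Proof.
move=> hloc hsep hX hp.
have fact d : d <> 0 -> exists n u, (exists w, u * w = 1) /\ d = p ^+ n * u.
  move=> d0.
  pose Pn n := `[< ~ exists c, d = p ^+ n * c >].
  have exP : exists n, Pn n.
    apply: contrapT => /forallNP no; apply: d0; apply: hsep => n.
    by apply: contrapT => h; apply: (no n); apply/asboolP.
  case: (ex_minnP exP) => -[|n] /asboolP hn minn.
    by case: hn; exists d; rewrite mul1r.
  have [c ec] : exists c, d = p ^+ n * c.
    apply: contrapT => h; have : Pn n by apply/asboolP.
    by move=> /minn; rewrite ltnn.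
  exists n, c; split=> //; case: (hloc c) => // -[c' ec'].
  by case: hn; exists c'; rewrite ec ec' exprSr mulrA.
(* [c] is arbitrary: for a unit [c] this gives uniqueness of the exponent, and for general [c] the
   ultrametric inequality. *)
have uniq n u k c : (exists w, u * w = 1) -> p ^+ n * u = p ^+ k * c -> (k <= n)%N.
  move=> [w uw] e; rewrite leqNgt; apply/negP => nk.
  have e0 : p ^+ n * (u - p ^+ (k - n) * c) = 0.
    by rewrite mulrBr mulrA -exprD subnKC ?(ltnW nk) // e subrr.
  have [[z hz]|[z hz]] := hloc (u - p ^+ (k - n) * c).
    by apply: (hX n); rewrite -[LHS]mulr1 -hz mulrA e0 mul0r.
  apply: hp; exists ((z + p ^+ (k - n).-1 * c) * w).
  rewrite mulrA mulrDr -hz mulrA -exprS prednK ?subn_gt0 //.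
  by rewrite subrK.
pose vP (d : D) n := exists u, (exists w, u * w = 1) /\ d = p ^+ n * u.
(* The value at zero is the default [0]; [is_DVR] constrains only nonzero elements. *)
pose v d := if pselect (exists n, vP d n) is left h then sval (cid h) else 0%N.
have vE d : d != 0 -> vP d (v d).
  move=> /eqP d0; rewrite /v; case: pselect => [h|]; first by case: (cid h).
  by case; exact: fact.
have vU d n : d != 0 -> vP d n -> v d = n.
  move=> /vE [u [hu eu]] [w [hw ew]]; apply/eqP; rewrite eqn_leq.
  by rewrite (uniq _ _ _ _ hw (etrans (esym ew) eu)) (uniq _ _ _ _ hu (etrans (esym eu) ew)).
have dom (x y : D) : x != 0 -> y != 0 -> x * y != 0.
  move=> /vE [u [[u' hu] eu]] /vE [w [[w' hw] ew]]; apply/eqP => e0.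
  apply: (hX (v x + v y)%N); rewrite -[LHS]mulr1 -{1}(mulr1 1) -{1}hu -hw.
  transitivity (x * y * (u' * w')); first by rewrite {2}eu {2}ew exprD; ring.
  by rewrite e0 mul0r.
split; first by apply/eqP => e; apply: (hX 0%N); rewrite expr0.
split.
  move=> x y e0; case: (eqVneq x 0) => [->|x0]; first by left.
  case: (eqVneq y 0) => [->|y0]; first by right.
  by have := dom x y x0 y0; rewrite e0 eqxx.
exists v; split; last split; last split.
- move=> x y x0 y0; apply: vU; first exact: dom.
  have [u [[u' hu] eu]] := vE x x0; have [w [[w' hw] ew]] := vE y y0.
  exists (u * w); split; first by exists (u' * w'); rewrite mulrACA hu hw mulr1.
  by rewrite {1}eu {1}ew exprD; ring.
- move=> x y x0 y0 xy0; have [u [_ eu]] := vE x x0; have [w [_ ew]] := vE y y0.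
  have [s [hs es]] := vE _ xy0.
  set l := minn (v x) (v y).
  apply: (uniq _ s _ (p ^+ (v x - l) * u + p ^+ (v y - l) * w) hs).
  rewrite -es mulrDr !mulrA -!exprD !subnKC ?geq_minl ?geq_minr //.
  by rewrite -eu -ew.
- have p0 : p != 0 by apply/eqP; have := hX 1%N; rewrite expr1.
  exists p; split=> //; apply: vU => //; exists 1.
  by split; [exists 1; rewrite mulr1 | rewrite mulr1 expr1].
- move=> x y x0 y0 le; have [u [[u' hu] eu]] := vE x x0; have [w [_ ew]] := vE y y0.
  exists (p ^+ (v y - v x) * w * u').
  transitivity (p ^+ (v y - v x) * p ^+ v x * w * (u * u')).
    by rewrite hu mulr1 -exprD subnK.
  by rewrite [X in _ = _ * X]eu; ring.
Qed.

(** * The kernel of the map from the completion to the completed integral closure *)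

Section Completion.
Variables (A T Q : comUnitRingType) (m : A) (h : {rmorphism A -> T}) (f : {rmorphism A -> Q}).
Hypotheses (hA : localr A) (hm : nonzerodivisor m) (hmu : m \isn't a GRing.unit).
Hypothesis nilp : forall s r : A, nonzerodivisor s -> r \isn't a GRing.unit ->
  exists j c, r ^+ j = s * c.
Hypotheses (hc : adic_completion m h).
Hypotheses (hQ : total_quotient f) (hst : stable_ring A) (hnf : ~ finite_closure_in f).

Let Ai := integral_over f.
Let MA := closure_max f.
Let M1 : ~ MA 1. Proof. exact: (closure_max1 hA hm hmu nilp hQ hst). Qed.
Let finj : injective f. Proof. exact: hQ.1. Qed.
Let um : f m \is a GRing.unit. Proof. exact: hQ.2.1. Qed.

(* The closure in [T] of the elements of [A] that are infinitely divisible in the integral closure. *)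
Definition nil_prime t := forall n, exists r b,
  [/\ Ai b, f r = f m ^+ n * b & exists u, t = h r + h m ^+ n * u].

Lemma nil_prime_ideal : is_ideal nil_prime.
Proof.
split; last split.
- move=> n; exists 0, 0; split; first exact: integral_over0.
    by rewrite rmorph0 mulr0.
  by exists 0; rewrite rmorph0 mulr0 addr0.
- move=> x y hx hy n; have [r [b [hb eb [u ->]]]] := hx n; have [s [c [hc' ec [v ->]]]] := hy n.
  exists (r + s), (b + c); split; first exact: integral_overD.
    by rewrite rmorphD eb ec mulrDr.
  by exists (u + v); rewrite rmorphD; ring.
- move=> t x hx n; have [r [b [hb eb [u ->]]]] := hx n.
  have [s [v ->]] := completion_approx hc n t.
  exists (s * r), (f s * b); split.
  + by apply: integral_overM => //; exact: integral_over_base.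
  + by rewrite rmorphM eb; ring.
  + by exists (h s * u + v * (h r + h m ^+ n * u)); rewrite rmorphM; ring.
Qed.

Lemma nil_prime_sqr0 x y : nil_prime x -> nil_prime y -> x * y = 0.
Proof.
move=> hx hy; apply: (completion_sep hc) => n.
have [r [b [hb eb [u eu]]]] := hx n; have [s [c [hc' ec [v ev]]]] := hy n.
have [a1 [a2 [a3 e]]] := product_span hm hmu nilp hQ hst hb hc'.
have ers : r * s = m ^+ n * (m ^+ n * a1 + a2 * r + a3 * s).
  apply: finj; rewrite rmorphM {1}eb {1}ec mulrACA e.
  by rewrite !(rmorphM, rmorphD, rmorphXn) /= eb ec; ring.
exists (h (m ^+ n * a1 + a2 * r + a3 * s) + u * y + h r * v).
have -> : x * y = h r * h s + h m ^+ n * (u * y + h r * v).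
  by rewrite {1}eu mulrDl {1}ev; ring.
by rewrite -rmorphM ers rmorphM rmorphXn; ring.
Qed.

Lemma nil_prime_proper : ~ nil_prime 1.
Proof.
move=> /(_ 1%N) [r [b [hb eb [u eu]]]].
have [s es] : exists s, 1 = r + m ^+ 1 * s.
  by apply: (completion_eq hc (u := u)); rewrite rmorph1.
apply: M1; rewrite (_ : 1 = f m * (b + f s)).
  apply: closure_maxMl; last exact: closure_max_base.
  by apply: integral_overD => //; exact: integral_over_base.
by rewrite -(rmorph1 f) es rmorphD eb rmorphM !expr1; ring.
Qed.

(** The geometric series converges in the completion. *)
Lemma completion_unit1B u : exists s, (1 - h m * u) * s = 1.
Proof.
pose x := h m * u; pose ts n := \sum_(i < n) x ^+ i.
have [|s hs] := hc.2.2.2 ts.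
  by move=> i; exists (u ^+ i); rewrite /ts big_ord_recr /= addrAC subrr add0r exprMn.
exists s; apply/eqP; rewrite -subr_eq0; apply/eqP.
apply: (completion_sep hc) => n; have [v ev] := hs n.
exists ((1 - x) * v - u ^+ n).
have e : (1 - x) * ts n = 1 - x ^+ n by rewrite -(opprB x 1) mulNr -subrX1 opprB.
have -> : s = ts n + h m ^+ n * v by rewrite -ev; ring.
by rewrite mulrDr -/x e exprMn; ring.
Qed.

(* The canonical map from the integral closure to [T] modulo [nil_prime], as a relation. *)
Definition approximates (b : Q) (t : T) := forall n, exists a c,
  [/\ Ai c, b = f a + f m ^+ n * c & exists u, t = h a + h m ^+ n * u].

(** Since a power of [g] is a multiple of [m], iterating [C = A + gC] gives [C = A + mC]. Iterating
    this in turn expands [b] as an [m]-adic series with digits in [A], whose sum in [T] is the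
    required element. *)
Lemma approximates_exists b : Ai b -> exists t, approximates b t.
Proof.
move=> hb; have [g [ng hg _]] := closure_structure hA hm hmu nilp hQ hst hnf.
have step y : Ai y -> exists a z, Ai z /\ y = f a + f m * z.
  have key j z : Ai z -> exists a w, Ai w /\ z = f a + f g ^+ j * w.
    elim: j z => [|j ih] z hz.
      by exists 0, z; split=> //; rewrite rmorph0; ring.
    have [a [w [hw ->]]] := ih z hz; have [a' [w' [hw' ->]]] := hg w hw.
    by exists (a + g ^+ j * a'), w'; split=> //; rewrite rmorphD rmorphM rmorphXn exprSr; ring.
  move=> hy; have [j [c e]] := nilp hm ng.
  have [a [w [hw ->]]] := key j y hy; exists a, (f c * w); split.
    by apply: integral_overM => //; exact: integral_over_base.
  by rewrite -rmorphXn e rmorphM mulrA.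
have step' (y : {y | Ai y}) : exists p : A * {y | Ai y}, sval y = f p.1 + f m * sval p.2.
  by case: y => y hy; have [a [z [hz e]]] := step y hy; exists (a, exist _ z hz).
have [F hF] := choice step'.
pose be n := iter n (fun y => (F y).2) (exist _ b hb).
pose s n := \sum_(i < n) m ^+ i * (F (be i)).1.
have es n : b = f (s n) + f m ^+ n * sval (be n).
  elim: n => [|n ih]; first by rewrite /s big_ord0 rmorph0 expr0 add0r mul1r.
  rewrite /s big_ord_recr /= -/(s n) [LHS]ih hF rmorphD rmorphM rmorphXn exprSr.
  by ring.
have [|t ht] := hc.2.2.2 (fun n => h (s n)).
  move=> n; exists (h (F (be n)).1).
  by rewrite /s big_ord_recr /= -/(s n) rmorphD rmorphM rmorphXn; ring.
exists t => n; exists (s n), (sval (be n)); split; first exact: svalP.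
  exact: es.
by have [u eu] := ht n; exists u; rewrite -eu; ring.
Qed.

(** Translates a divisibility in the integral closure into a congruence in [T] modulo
    [nil_prime]. *)
Lemma nil_prime_approx r c z t : f r = f c * z -> approximates z t -> nil_prime (h r - h c * t).
Proof.
move=> e hz n; have [a [w [hw ea [u eu]]]] := hz n.
exists (r - c * a), (f c * w); split.
- by apply: integral_overM => //; exact: integral_over_base.
- by rewrite rmorphB rmorphM e ea; ring.
- by exists (- h c * u); rewrite eu rmorphB rmorphM; ring.
Qed.

(** Some integral element lies outside [A], and a minimal denominator exponent yields [b'] outside
    [A] with [m b' = r] in [A]. So [m] divides [r] in the closure but not in [A]: subtracting from
    [h r] the multiple [h m * t], with [t] approximating [b'], gives an element of the prime that
    cannot vanish. *)
Lemma nil_prime_neq0 : exists p, nil_prime p /\ p <> 0.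
Proof.
have [b [hb nb]] : exists b, Ai b /\ ~ exists a, b = f a.
  apply: contrapT => no; apply: hnf.
  apply: (@finite_of_span _ _ f 1) => [|y hy]; first exact: integral_over1.
  have [a ->] : exists a, y = f a by apply: contrapT => h'; apply: no; exists y.
  by exists a, 0; rewrite rmorph0 mul0r addr0.
pose Pn n := `[< exists a, f m ^+ n * b = f a >].
have exP : exists n, Pn n.
  have [k [a ha]] := denominator hmu nilp hQ b.
  by exists k; apply/asboolP; exists a.
case: (ex_minnP exP) => -[|k] /asboolP [r er] minn.
  by case: nb; exists r; rewrite -er mul1r.
pose b' := f m ^+ k * b.
have hb' : Ai b'.
  by apply: integral_overM => //; apply: integral_overX; exact: integral_over_base.
have nb' : ~ exists a, b' = f a.
  by move=> h'; have : Pn k by [apply/asboolP]; move=> /minn; rewrite ltnn.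
have er' : f r = f m * b' by rewrite -er exprS mulrA.
have [t ht] := approximates_exists hb'.
exists (h r - h m * t); split; first exact: nil_prime_approx ht.
move=> /eqP; rewrite subr_eq0 => /eqP e0.
have [r' er2] : exists r', r = m ^+ 1 * r' by apply: (completion_dvd hc (u := t)).
by apply: nb'; exists r'; apply: (mulrI um); rewrite -er' er2 expr1 rmorphM.
Qed.

Lemma nil_prime_DVR (D : comUnitRingType) (psi : {rmorphism T -> D}) :
  (forall d, exists t, psi t = d) -> (forall t, psi t = 0 <-> nil_prime t) -> is_DVR D.
Proof.
move=> hpsi kpsi.
have psi_eq x y : nil_prime (x - y) -> psi x = psi y.
  by move=> /kpsi; rewrite rmorphB => /eqP; rewrite subr_eq0 => /eqP.
have [g [ng hg hMg]] := closure_structure hA hm hmu nilp hQ hst hnf.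
have dvdg r : r \isn't a GRing.unit -> exists t, psi (h r) = psi (h g) * psi t.
  move=> nr; have [z [hz ez]] := hMg r nr; have [t ht] := approximates_exists hz.
  by exists t; rewrite -rmorphM; apply: psi_eq; exact: nil_prime_approx ht.
apply: (@DVR_of_uniformizer _ (psi (h g))).
- move=> d; have [t <-] := hpsi d.
  have [r [u et]] := completion_approx hc 1 t; rewrite expr1 in et.
  case: (boolP (r \is a GRing.unit)) => [ur|nr]; [left|right].
    have [s hs] := completion_unit1B (- (h r^-1 * u)).
    exists (psi (h r^-1 * s)); rewrite -rmorphM -(rmorph1 psi); congr (psi _).
    have e1 : h r * h r^-1 = 1 by rewrite -rmorphM divrr // rmorph1.
    rewrite -hs et; transitivity ((h r * h r^-1) * s + h m * (h r^-1 * u) * s); first by ring.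
    by rewrite e1; ring.
  have [t1 e1] := dvdg r nr; have [t2 e2] := dvdg m hmu.
  by exists (psi t1 + psi t2 * psi u); rewrite et rmorphD rmorphM e1 e2; ring.
- move=> d; have [t <-] := hpsi d => hd; apply/kpsi => n.
  (* Divisibility by this power of [g] implies divisibility by [m ^+ n], the precision at which
     membership is tested. *)
  have [j [c ec]] := nilp (@nonzerodivisorX _ m n hm) ng.
  have [d' ed] := hd j; have [t' et'] := hpsi d'.
  have /kpsi /(_ n) [r [b [hb eb [u eu]]]] : psi (t - h g ^+ j * t') = 0.
    by rewrite rmorphB rmorphM rmorphXn et' ed subrr.
  exists r, b; split=> //; exists (u + h c * t').
  have -> : t = (t - h g ^+ j * t') + h g ^+ j * t' by ring.
  by rewrite eu -[h g ^+ j]rmorphXn ec rmorphM rmorphXn; ring.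
(* Testing at precision [n.+1] would make [g ^+ n] a multiple of [m ^+ n.+1] in the closure, while
   [m ^+ n] is a multiple of [g ^+ n]; cancelling [m ^+ n] puts [1] into [MA]. *)
- move=> n; rewrite -!rmorphXn => /kpsi /(_ n.+1) [r [b [hb eb [u eu]]]].
  have [s es] := completion_eq hc eu.
  have [z [hz ez]] := hMg m hmu.
  apply: M1; rewrite (_ : 1 = f m * ((b + f s) * z ^+ n)).
    apply: closure_maxMl; last exact: closure_max_base.
    apply: integral_overM; last exact: integral_overX.
    by apply: integral_overD => //; exact: integral_over_base.
  have umn : f m ^+ n \is a GRing.unit by rewrite unitrX.
  have eg : f g ^+ n = f m ^+ n.+1 * (b + f s).
    by rewrite -rmorphXn es rmorphD eb rmorphM rmorphXn; ring.
  apply: (mulrI umn); rewrite mulr1 [LHS](congr1 (fun y => y ^+ n) ez) exprMn eg exprSr.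
  by ring.
- move=> [c hc']; have [t et] := hpsi c.
  have : psi (h g * t - 1) = 0 by rewrite rmorphB rmorphM et hc' rmorph1 subrr.
  move=> /kpsi /(_ 1%N) [r [b [hb eb [u eu]]]].
  have [r' [u' eu']] := completion_approx hc 1 t.
  have [s es] : exists s, g * r' - 1 = r + m ^+ 1 * s.
    apply: (completion_eq hc (u := u - h g * u')).
    rewrite rmorphB rmorphM rmorph1.
    transitivity (h g * t - 1 - h m ^+ 1 * (h g * u')); first by rewrite eu'; ring.
    by rewrite eu; ring.
  apply: M1; rewrite (_ : 1 = f g * f r' - f m * (b + f s)).
    apply: closure_maxB; apply: closure_maxMl; try exact: closure_max_base.
      exact: integral_over_base.
    by apply: integral_overD => //; exact: integral_over_base.
  rewrite -(rmorph1 f) -rmorphM (_ : g * r' = 1 + r + m ^+ 1 * s); last by rewrite -addrA -es; ring.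
  by rewrite !rmorphD eb rmorphM !expr1; ring.
Qed.

Lemma completion_nil_prime : exists P : T -> Prop, prime_ideal P /\ (exists x, P x /\ x <> 0) /\
  (forall x y, P x -> P y -> x * y = 0) /\ quotient_is_DVR P.
Proof.
have [D [psi [hpsi kpsi]]] := ideal_quotient nil_prime_ideal nil_prime_proper.
have hD := nil_prime_DVR hpsi kpsi.
exists nil_prime; split; last split; last split.
- split; first exact: nil_prime_ideal.
  split; first exact: nil_prime_proper.
  move=> a b /kpsi; rewrite rmorphM => /(hD.2.1) [] /kpsi; [by left | by right].
- exact: nil_prime_neq0.
- exact: nil_prime_sqr0.
- by exists D, psi.
Qed.

End Completion.

(** * Transfer to the quotient, and the theorem *)

Definition nil_prime_with_DVR (T : comUnitRingType) :=
  exists P : T -> Prop, prime_ideal P /\ (exists x, P x /\ x <> 0) /\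
    (forall x y, P x -> P y -> x * y = 0) /\ quotient_is_DVR P.

(** Stated for an arbitrary local ring and any of its completions, so that it serves both the given
    ring and its quotient by [J]. *)
Lemma stable_iff_completion (A T : comUnitRingType) (m : A) (h : {rmorphism A -> T}) :
  localr A -> no_prime_chain A -> nonzerodivisor m -> m \isn't a GRing.unit ->
  adic_completion m h ->
  (stable_ring A /\ ~ finite_integral_closure A) <-> nil_prime_with_DVR T.
Proof.
move=> hA hch hm hmu hc; split.
  move=> [hst hfin].
  have [Q [f [hQ hnf]]] : exists (Q : comUnitRingType) (f : {rmorphism A -> Q}),
      total_quotient f /\ ~ finite_closure_in f.
    apply: contrapT => no; apply: hfin => Q f hQ; apply: contrapT => hf.
    by apply: no; exists Q, f.
  by apply: (completion_nil_prime hA hm hmu _ hc hQ hst hnf) => s r; exact: nonzerodivisor_dvd_pow.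
move=> [P [hP [Pne [P2 [D [psi [hpsi [kpsi hD]]]]]]]].
have dm s : nonzerodivisor s -> exists j c, m ^+ j = s * c.
  by move=> hs; exact: nonzerodivisor_dvd_pow.
split; first exact: (stable_of_completion hc hA hm hmu P2 hpsi kpsi hD dm).
exact: (not_finite_of_completion hc hm P2 dm Pne).
Qed.

Section Surjection.
Variables (A S : comUnitRingType) (p : {rmorphism A -> S}).
Hypotheses (hA : localr A) (hp : forall s, exists a, p a = s).
Hypothesis kp : forall a, p a = 0 -> a \isn't a GRing.unit.

Lemma unit_of_surjection a : p a \is a GRing.unit -> a \is a GRing.unit.
Proof.
move=> /unitrP [s [_ e]]; have [b eb] := hp s.
have nk : a * b - 1 \isn't a GRing.unit by apply: kp; rewrite rmorphB rmorphM rmorph1 eb e subrr.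
have : 1 + (a * b - 1) \is a GRing.unit by apply: unitD_nonunit; rewrite ?unitr1.
by rewrite addrC subrK unitrM => /andP[].
Qed.

Lemma localr_surjection : localr S.
Proof.
move=> s t; have [a <-] := hp s; have [b <-] := hp t.
by rewrite -rmorphD => /unit_of_surjection /hA [] /(rmorph_unit p); [left | right].
Qed.

Lemma prime_preimage (P : S -> Prop) : prime_ideal P -> prime_ideal (fun a => P (p a)).
Proof.
move=> [[P0 [PD PM]] [P1 PP]]; split; first split; [|split|].
- by rewrite rmorph0.
- by move=> x y; rewrite rmorphD; exact: PD.
- by move=> r x; rewrite rmorphM; exact: PM.
- by rewrite rmorph1; split=> // a b; rewrite rmorphM; exact: PP.
Qed.

Lemma strict_subset_preimage (P P' : S -> Prop) :
  strict_subset P P' -> strict_subset (fun a => P (p a)) (fun a => P' (p a)).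
Proof.
move=> [h [s [h1 h2]]]; split; first by move=> a; exact: h.
by have [a ea] := hp s; exists a; rewrite ea.
Qed.

Lemma no_prime_chain_surjection : no_prime_chain A -> no_prime_chain S.
Proof.
move=> h [P0 [P1 [P2 [h0 [h1 [h2 [h3 h4]]]]]]]; apply: h.
exists (fun a => P0 (p a)), (fun a => P1 (p a)), (fun a => P2 (p a)).
do 3!(split; first exact: prime_preimage).
by split; exact: strict_subset_preimage.
Qed.

Lemma adic_completion_surjection (T : comUnitRingType) (m : A) (g : {rmorphism A -> T})
    (h : {rmorphism S -> T}) :
  (forall a, h (p a) = g a) -> adic_completion m g -> adic_completion (p m) h.
Proof.
move=> hg [c1 [c2 [c3 c4]]]; rewrite /adic_completion hg; split; last split; last split=> //.
- by move=> i t; have [r [u ->]] := c1 i t; exists (p r), u; rewrite hg.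
- move=> i s; have [r <-] := hp s; rewrite hg => /c2 [r' ->].
  by exists (p r'); rewrite rmorphM rmorphXn.
Qed.

End Surjection.

Lemma adic_intersection_ideal (A : comUnitRingType) (m : A) :
  is_ideal (fun x => forall i, (0 < i)%N -> exists r, x = m ^+ i * r).
Proof.
split; first by move=> i _; exists 0; rewrite mulr0.
split.
  move=> x y hx hy i i0; have [r ->] := hx i i0; have [s ->] := hy i i0.
  by exists (r + s); rewrite mulrDr.
by move=> r x hx i i0; have [s ->] := hx i i0; exists (r * s); ring.
Qed.

Theorem theorem4p7 (R : comUnitRingType) (M : R -> Prop) (m : R)
  (hM : maximal_ideal M)
  (hlocal : forall N : R -> Prop, maximal_ideal N -> forall x, N x <-> M x)
  (hdim : krull_dim_one R)
  (hMreg : regular_ideal M)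
  (hmM : M m) (hm : nonzerodivisor m) :
  let J : R -> Prop := fun x => forall i : nat, (0 < i)%N -> exists r, x = m ^+ i * r in
  let st1 := stable_ring R /\ ~ finite_integral_closure R in
  let st2 := forall (S : comUnitRingType) (pi : {rmorphism R -> S}),
      (forall s, exists r, pi r = s) -> (forall r, pi r = 0 <-> J r) ->
      stable_ring S /\ ~ finite_integral_closure S in
  let st3 := forall (T : comUnitRingType) (g : {rmorphism R -> T}),
      adic_completion m g ->
      exists P : T -> Prop, prime_ideal P /\ (exists x, P x /\ x <> 0) /\
        (forall x y, P x -> P y -> x * y = 0) /\ quotient_is_DVR P in
  (st1 <-> st2) /\ (st2 <-> st3).
Proof.
move=> J st1 st2 st3.
have Mu := maximal_ideal_nonunits hM hlocal.
have hA : localr R.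
  move=> x y u; apply: contrapT => /not_orP[/negP/Mu Mx /negP/Mu My].
  have /Mu : M (x + y) by apply: hM.1.2.1.
  by rewrite u.
have hmu : m \isn't a GRing.unit by apply/Mu.
have hch : no_prime_chain R := hdim.2.
have J_nonunit r : J r -> r \isn't a GRing.unit.
  by move=> /(_ 1%N isT) [s ->]; rewrite expr1; exact: nonunitM.
(* [st2] and [st3] range over all quotients and all completions; the fixed models [S0] and [T0] are
   the pivots through which the three statements are compared. *)
have [T0 [g0 hg0]] : exists (T : comUnitRingType) (g : {rmorphism R -> T}), adic_completion m g.
  by apply: adic_completion_exists => // -[r e]; move: hmu; rewrite (@unit_of _ m r).
have [S0 [p0 [sp0 kp0]]] : exists (S : comUnitRingType) (p : {rmorphism R -> S}),
    (forall s, exists r, p r = s) /\ (forall r, p r = 0 <-> J r).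
  by apply: ideal_quotient (adic_intersection_ideal m) _ => /J_nonunit; rewrite unitr1.
have eqS (T : comUnitRingType) (g : {rmorphism R -> T}) (S : comUnitRingType)
    (p : {rmorphism R -> S}) : adic_completion m g ->
    (forall s, exists r, p r = s) -> (forall r, p r = 0 <-> J r) ->
    (stable_ring S /\ ~ finite_integral_closure S) <-> nil_prime_with_DVR T.
  move=> hg sp kp.
  have kn r : p r = 0 -> r \isn't a GRing.unit by move=> /kp; exact: J_nonunit.
  have [h hh] : exists h : {rmorphism S -> T}, forall a, h (p a) = g a.
    apply: rmorphism_factor => // a /kp Ja; apply: (completion_sep hg) => -[|i].
      by exists (g a); rewrite mul1r.
    by have [r ->] := Ja i.+1 isT; exists (g r); rewrite rmorphM rmorphXn.
  apply: (stable_iff_completion (m := p m) (h := h)).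
  - exact: localr_surjection hA sp kn.
  - exact: no_prime_chain_surjection.
  (* [m] stays a nonzerodivisor modulo [J]: if [m * r] is divisible by [m ^+ i.+1], cancelling one
     factor shows that [r] is divisible by [m ^+ i]. *)
  - move=> s; have [r <-] := sp s; rewrite -rmorphM => /kp hJ; apply/kp => i i0.
    have [r' e] := hJ i.+1 isT; exists r'; apply: (nonzerodivisor_cancel hm).
    by rewrite e exprS mulrA.
  - by apply/negP => /(unit_of_surjection hA sp kn); apply/negP.
  - exact: adic_completion_surjection hg.
have eqR := stable_iff_completion hA hch hm hmu hg0.
split; split.
- by move=> /eqR h S p sp kp; apply/(eqS T0 g0).
- by move=> h; apply/eqR/(eqS T0 g0 S0 p0 hg0 sp0 kp0); exact: h.
- by move=> h T g hg; apply/(eqS T g S0 p0 hg sp0 kp0); exact: h.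
- by move=> h S p sp kp; apply/(eqS T0 g0 S p hg0 sp kp); exact: (h T0 g0 hg0).
Qed.
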